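(* Let $n\ge 4$. Then the reduced homology group $\tilde{H}_i(\mathcal{N}(\mathbb{I}_n,3);\mathbb{Z})$ is nonzero if and only if $i\in\{3,4\}$.
   Context: For a finite simple connected graph $G$ and a real number $r\ge 0$, the Čech complex $\mathcal{N}(G,r)$ is the simplicial complex with vertex set $V(G)$ in which a finite nonempty set $\sigma\subseteq V(G)$ is a simplex if and only if the closed balls of radius $\frac r2$ centered at the vertices of $\sigma$ have a common point, the balls being taken in the geometric realization of $G$ with the shortest path metric in which each edge is isometric to $[0,1]$. The hypercube graph $\mathbb{I}_n$ has vertex set $\{0,1\}^n$, two vertices adjacent iff they differ in exactly one coordinate. *)

(* Defs.v *)
From HB Require Import structures.
From mathcomp Require Import boolp classical_sets reals.
From mathcomp Require Import all_boot all_order all_algebra.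
From mathcomp Require Import ring_quotient.

Set Implicit Arguments.
Unset Strict Implicit.
Unset Printing Implicit Defensive.

Import Order.TTheory GRing.Theory Num.Theory.
Local Open Scope ring_scope.

Record conn_graph := ConnGraph {
  vertex :> finType;
  adj : rel vertex;
  adj_sym : symmetric adj;
  adj_irr : irreflexive adj;
  adj_conn : forall u v, connect adj u v }.

Section GeometricRealization.
Variables (R : realType) (G : conn_graph).

(* Points of the geometric realization are given by their barycentric
   coordinates: a function G -> R supported on a vertex or on an edge.
   [edge_point u v t] is the point at distance t from u on the edge uv. *)
Definition vertex_point (v : G) : {ffun G -> R} := [ffun w => (w == v)%:R].

Definition edge_point (u v : G) (t : R) : {ffun G -> R} :=
  [ffun w => (1 - t) * (w == u)%:R + t * (w == v)%:R].

Definition realization : set {ffun G -> R} :=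
  [set x | (exists v, x = vertex_point v) \/
           (exists u v t, [/\ adj u v, 0 <= t <= 1 & x = edge_point u v t])]%classic.

(* [route x y l]: a path of length l from x to y, made of finitely many
   segments, each inside one closed edge parametrized by [0, 1]. *)
Inductive route : {ffun G -> R} -> {ffun G -> R} -> R -> Prop :=
| route_nil x : route x x 0
| route_cons u v s t y l : adj u v -> 0 <= s <= 1 -> 0 <= t <= 1 ->
    route (edge_point u v t) y l ->
    route (edge_point u v s) y (`|s - t| + l).

Definition path_dist (x y : {ffun G -> R}) : R :=
  inf [set l | route x y l]%classic.

Definition closed_ball_at (x : {ffun G -> R}) (r : R) : set {ffun G -> R} :=
  [set y | realization y /\ path_dist x y <= r]%classic.

End GeometricRealization.

Record simplicial_complex (V : finType) := SimplicialComplex {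
  simplices : {set {set V}};
  simplices_neq0 : set0 \notin simplices;
  simplices_sub : forall s t : {set V},
    s \in simplices -> t \subset s -> t != set0 -> t \in simplices }.

Section Cech.
Variables (R : realType) (G : conn_graph) (r : R).

Definition cech_simplices : {set {set G}} :=
  [set s : {set G} | (s != set0) &&
    `[< exists p, forall v, v \in s ->
          closed_ball_at (vertex_point R v) (r / 2) p >]].

Fact cech_simplices_neq0 : set0 \notin cech_simplices.
Proof. by rewrite inE eqxx. Qed.

Fact cech_simplices_sub (s t : {set G}) :
  s \in cech_simplices -> t \subset s -> t != set0 -> t \in cech_simplices.
Proof.
rewrite !inE => /andP[_ /asboolP[p Hp]] /subsetP ts -> /=.
by apply/asboolP; exists p => v /ts; exact: Hp.
Qed.

Definition cech : simplicial_complex G :=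
  SimplicialComplex cech_simplices_neq0 cech_simplices_sub.

End Cech.

Section ReducedHomology.
Variables (V : finType) (K : simplicial_complex V).

Definition chain := {ffun {set V} -> int}.

(* The empty set spans the chain group in degree -1 (augmentation). *)
Definition is_simplex_of_dim (i : int) (s : {set V}) : bool :=
  ((s == set0) || (s \in simplices K)) && (#|s|%:Z == i + 1).

Definition chains (i : int) : {pred chain} :=
  [pred c : chain | [forall s, (c s != 0) ==> is_simplex_of_dim i s]].

(* Simplices are oriented by the enumeration order of V: the sign of the facet
   [s :\ v] in the boundary of s is (-1)^k, with k the position of v in s. *)
Definition vertex_position (s : {set V}) (v : V) : nat :=
  #|[set w in s | (enum_rank w < enum_rank v)%N]|.

Definition bdry (c : chain) : chain :=
  [ffun t : {set V} =>
    \sum_(s : {set V}) \sum_(v in s | s :\ v == t)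
      (-1) ^+ vertex_position s v * c s].

Fact bdry_is_zmod_morphism : zmod_morphism bdry.
Proof.
move=> c d; apply/ffunP => t; rewrite !ffunE -sumrB.
apply: eq_bigr => s _; rewrite -sumrB; apply: eq_bigr => v _.
by rewrite !ffunE mulrBr.
Qed.
HB.instance Definition _ :=
  GRing.isZmodMorphism.Build chain chain bdry bdry_is_zmod_morphism.

Fact chains_zmod_closed i : zmod_closed (chains i).
Proof.
split=> [|c d]; rewrite ?inE.
  by apply/forallP => s; rewrite ffunE eqxx.
move=> /forallP cP /forallP dP; apply/forallP => s; apply/implyP.
move: (cP s) (dP s); rewrite !ffunE.
by case: (eqVneq (c s) 0) => [->|//]; case: (eqVneq (d s) 0) => [->|//]; rewrite subrr.
Qed.
HB.instance Definition _ i :=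
  GRing.isZmodClosed.Build chain (chains i) (chains_zmod_closed i).

Definition cycles (i : int) : {pred chain} :=
  [pred c : chain | (c \in chains i) && (bdry c == 0)].

Fact cycles_zmod_closed i : zmod_closed (cycles i).
Proof.
split=> [|c d]; first by apply/andP; rewrite raddf0 eqxx; split=> //; exact: rpred0.
move=> /andP[cC /eqP c0] /andP[dC /eqP d0]; apply/andP; split; first exact: rpredB.
by rewrite raddfB /= c0 d0 subrr.
Qed.
HB.instance Definition _ i :=
  GRing.isZmodClosed.Build chain (cycles i) (cycles_zmod_closed i).

Record cycle (i : int) := Cycle { cycle_val :> chain; _ : cycle_val \in cycles i }.
HB.instance Definition _ i := [isSub for @cycle_val i].
HB.instance Definition _ i := [Choice of cycle i by <:].
HB.instance Definition _ i := [SubChoice_isSubZmodule of cycle i by <:].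

Definition boundaries (i : int) : {pred cycle i} :=
  [pred z : cycle i | `[< exists2 b, b \in chains (i + 1) & bdry b = z >]].

Fact boundaries_zmod_closed i : zmod_closed (@boundaries i).
Proof.
split=> [|x y]; rewrite !inE.
  by apply/asboolP; exists 0; rewrite ?rpred0 ?raddf0.
move=> /asboolP[b bC bx] /asboolP[d dC dy]; apply/asboolP.
by exists (b - d); rewrite ?rpredB // raddfB /= bx dy.
Qed.
HB.instance Definition _ i :=
  GRing.isZmodClosed.Build (cycle i) (@boundaries i) (boundaries_zmod_closed i).

Definition reduced_homology (i : int) : zmodType := Quotient.quot (@boundaries i).

End ReducedHomology.

Section Hypercube.
Variable n : nat.

Definition hypercube_vertex : finType := {ffun 'I_n -> bool}.

Definition hypercube_adj : rel hypercube_vertex :=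
  fun x y => #|[set k | x k != y k]| == 1%N.

Fact hypercube_adj_sym : symmetric hypercube_adj.
Proof.
move=> x y; rewrite /hypercube_adj.
by under eq_finset => k do rewrite eq_sym.
Qed.

Fact hypercube_adj_irr : irreflexive hypercube_adj.
Proof.
move=> x; rewrite /hypercube_adj.
by under eq_finset => k do rewrite eqxx; rewrite (eqP (_ : finset _ == set0)%bool) ?cards0.
Qed.

Fact hypercube_adj_conn x y : connect hypercube_adj x y.
Proof.
move: {2}_.+1 (ltnSn #|[set k | x k != y k]|) => m; elim: m x => // m IH x lem.
have [/eqP|[k kP]] := set_0Vmem [set k | x k != y k].
  rewrite -subset0 => /subsetP e0; suff -> : x = y by exact: connect0.
  by apply/ffunP => k; apply/eqP; apply/negPn/negP => h; have := e0 k; rewrite !inE h => /(_ isT).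
pose z : hypercube_vertex := [ffun j => if j == k then y k else x j].
apply: (@connect_trans _ _ z).
  apply: connect1; rewrite /hypercube_adj.
  apply/cards1P; exists k; apply/setP => j; rewrite !inE ffunE.
  by case: (eqVneq j k) => [->|_]; [move: kP; rewrite inE | rewrite eqxx].
apply: IH; apply: leq_trans (_ : (#|[set k | x k != y k]| <= m)%N); last by [].
apply/proper_card/properP; split.
  by apply/subsetP => j; rewrite !inE ffunE; case: (eqVneq j k) => [->|//]; rewrite eqxx.
by exists k => //; rewrite inE ffunE !eqxx.
Qed.

Definition hypercube : conn_graph :=
  ConnGraph hypercube_adj_sym hypercube_adj_irr hypercube_adj_conn.

End Hypercube.

(* Main.v *)
From HB Require Import structures.
From mathcomp Require Import boolp classical_sets reals.
From mathcomp Require Import all_boot all_order all_algebra.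
From mathcomp Require Import generic_quotient ring_quotient zify ring lra.
Require Import Defs.

Set Implicit Arguments.
Unset Strict Implicit.
Unset Printing Implicit Defensive.

Import Order.TTheory GRing.Theory Num.Theory.
Local Open Scope ring_scope.

(** A set is a simplex iff it lies in N(a) ∪ N(b) for some edge ab, where N
    denotes open neighbourhoods. Call a set a star if it lies in a closed
    neighbourhood N[v]. Every homology is obtained by coning.

    Degrees at least 5. A simplex with at least five vertices contained in the
    neighbourhoods of two edges lies, up to one vertex, in N[v] for a common end
    v. So the part of a cycle carried by one edge ab has its boundary among such
    sets, and coning from a moves the cycle to them. There the centre v is unique
    and coning from v kills the cycle.

    Degrees at most 2. Coning from the odd end b of a carrying edge, and then
    from a chosen middle vertex for every pair at distance 3, makes a cycle a sum
    of stars. The vertices of a star can be pushed one by one along a coordinate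
    direction without leaving the neighbourhood of an edge, so the cycle is
    pushed to a point.

    Degrees 3 and 4. A join of boundaries of simplices in a 4-cube (3-cube) is a
    cycle that pairs to 1 with a cocycle modulo 2, pulled back along the
    projection onto that subcube. *)

(** * Cones and boundaries *)

Section ChainOperators.
Variable V : finType.
Implicit Types (s t : {set V}) (v w : V) (c : chain V).

Definition sg s v : int := (-1) ^+ vertex_position s v.

(** Contraction with the covector dual to [v] in the exterior algebra; [cone v] is the exterior
    product with [v]. Their anticommutation relations carry the sign bookkeeping. *)
Definition face_del v c : chain V :=
  [ffun t : {set V} => if v \in t then 0 else sg t v * c (v |: t)].

Definition cone v c : chain V :=
  [ffun s : {set V} => if v \in s then sg s v * c (s :\ v) else 0].

Definition restr (P : pred {set V}) c : chain V :=
  [ffun s : {set V} => if P s then c s else 0].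

Definition supported (P : {set V} -> Prop) c := forall s, c s != 0 -> P s.

Lemma sg_sqr s v : sg s v * sg s v = 1.
Proof. by rewrite -expr2 sqrr_sign. Qed.

Lemma sg_neq0 s v : sg s v != 0.
Proof. by rewrite signr_eq0. Qed.

Lemma sgU1 s v : sg (v |: s) v = sg s v.
Proof.
congr (_ ^+ _); apply: eq_card => w; rewrite !inE.
by case: eqP => [->|//]; rewrite ltnn !andbF.
Qed.

Lemma sgD1 s v : sg (s :\ v) v = sg s v.
Proof.
congr (_ ^+ _); apply: eq_card => w; rewrite !inE.
by case: eqP => [->|//]; rewrite ltnn !andbF.
Qed.

Lemma sgU1_other s v w : w \notin s ->
  sg (w |: s) v = (-1) ^+ (enum_rank w < enum_rank v)%N * sg s v.
Proof.
move=> ws; rewrite /sg -exprD; congr (_ ^+ _); rewrite /vertex_position.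
case wv: (enum_rank w < enum_rank v)%N => /=.
  rewrite (cardsD1 w) !inE eqxx wv /=; congr (_ + _)%N; apply: eq_card => u.
  by rewrite !inE; case: eqP => [->|//]; rewrite (negPf ws).
rewrite add0n; apply: eq_card => u; rewrite !inE.
by case: eqP => [->|//]; rewrite wv !andbF.
Qed.

Lemma rank_total v w : v != w ->
  (-1) ^+ (enum_rank w < enum_rank v)%N
    = - (-1) ^+ (enum_rank v < enum_rank w)%N :> int.
Proof.
move=> vw; case: ltngtP => [||/ord_inj/enum_rank_inj vw']; rewrite ?expr1 ?expr0 ?opprK //.
by rewrite vw' eqxx in vw.
Qed.

Lemma sg_exchange s v w : v != w -> v \notin s -> w \notin s ->
  sg s v * sg (v |: s) w = - (sg s w * sg (w |: s) v).
Proof.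
move=> vw vs ws; rewrite !sgU1_other // (rank_total vw); ring.
Qed.

Lemma face_del_is_zmod_morphism v : zmod_morphism (face_del v).
Proof.
move=> c d; apply/ffunP => t; rewrite !ffunE.
by case: ifP => _; rewrite ?subr0 // mulrBr.
Qed.
HB.instance Definition _ v := GRing.isZmodMorphism.Build (chain V) (chain V)
  (face_del v) (face_del_is_zmod_morphism v).

Lemma cone_is_zmod_morphism v : zmod_morphism (cone v).
Proof.
move=> c d; apply/ffunP => t; rewrite !ffunE.
by case: ifP => _; rewrite ?subr0 // mulrBr.
Qed.
HB.instance Definition _ v := GRing.isZmodMorphism.Build (chain V) (chain V)
  (cone v) (cone_is_zmod_morphism v).

Lemma bdryE c : bdry c = \sum_v face_del v c.
Proof.
apply/ffunP => t; rewrite ffunE sum_ffunE.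
transitivity (\sum_v \sum_(s : {set V} | (v \in s) && (s :\ v == t))
  sg s v * c s); last first.
  apply: eq_bigr => v _; rewrite ffunE; case: ifP => vt.
    rewrite big1 // => s /andP[vs /eqP st].
    by rewrite -st !inE eqxx in vt.
  rewrite (big_pred1 (v |: t)) ?sgU1 // => s /=; apply/andP/eqP => [[vs /eqP <-]|->].
    by rewrite setD1K.
  by rewrite !inE eqxx setU1K // vt.
by rewrite (exchange_big_dep xpredT).
Qed.

Lemma face_del_anti v w c :
  face_del v (face_del w c) = - face_del w (face_del v c).
Proof.
apply/ffunP => t; rewrite !ffunE !inE.
have [->|vw] := eqVneq v w.
  by rewrite ?eqxx /=; case: ifP; rewrite ?mulr0 oppr0.
rewrite ?(negPf vw) ?(eq_sym w v) ?(negPf vw) /=.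
case: ifPn => vt; case: ifPn => wt; rewrite ?mulr0 ?oppr0 //.
by rewrite !mulrA sg_exchange // mulNr setUCA.
Qed.

Lemma face_del_cone v w c :
  face_del w (cone v c) = (if w == v then c else 0) - cone v (face_del w c).
Proof.
apply/ffunP => t; have [->|vw] := eqVneq w v; rewrite !ffunE !inE ?eqxx /=.
  rewrite sgD1; case: ifPn => vt.
    by rewrite setD1K // mulrA sg_sqr mul1r subrr.
  by rewrite setU1K // sgU1 mulrA sg_sqr mul1r subr0.
rewrite ?(eq_sym v w) ?(negPf vw) /= sub0r.
case: ifPn => wt; case: ifPn => vt; rewrite ?mulr0 ?oppr0 //.
have -> : (w |: t) :\ v = w |: t :\ v.
  by apply/setP => u; rewrite !inE; case: (eqVneq u v) => [->|//]; rewrite eq_sym (negPf vw).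
rewrite !mulrA -mulNr; congr (_ * _).
rewrite -(sgD1 t v) -{1 2}(setD1K vt) setUCA sgU1.
have vt' : v \notin t :\ v by rewrite !inE eqxx.
have wt' : w \notin t :\ v by rewrite !inE (negPf wt) andbF.
rewrite (sgU1_other w vt') (sgU1_other v wt') (rank_total vw).
by case: (_ < _)%N; rewrite ?expr0 ?expr1; ring.
Qed.

Lemma bdry_bdry c : bdry (bdry c) = 0.
Proof.
(* Face deletions anticommute, so the double sum is its own negative, and the integers have no
   2-torsion. *)
have e : bdry (bdry c) = - bdry (bdry c).
  rewrite {1}(bdryE c) raddf_sum /=; under eq_bigr do rewrite bdryE.
  rewrite (bdryE (bdry c)) -sumrN; apply: eq_bigr => w _.
  rewrite (bdryE c) raddf_sum /= -sumrN; apply: eq_bigr => v _.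
  exact: face_del_anti.
by apply/ffunP => t; move/ffunP/(_ t): e; rewrite !ffunE; lia.
Qed.

(** The anticommutation relation summed over all vertices: coning is a contracting homotopy.
    Simplices through [v] have zero cone. *)
Lemma bdry_cone v c : bdry (cone v c) = c - cone v (bdry c).
Proof.
rewrite !bdryE raddf_sum /=; under eq_bigr do rewrite face_del_cone.
by rewrite sumrB -big_mkcond big_pred1_eq.
Qed.

Lemma bdry_supp c t : bdry c t != 0 -> exists2 w, w \notin t & c (w |: t) != 0.
Proof.
apply: contra_neqP => nex; rewrite bdryE sum_ffunE big1 // => w _; rewrite ffunE.
case: ifPn => // wt; have [->|nz] := eqVneq (c (w |: t)) 0; first by rewrite mulr0.
by case: nex; exists w.
Qed.

Lemma cone_supp v c s : cone v c s != 0 -> v \in s /\ c (s :\ v) != 0.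
Proof. by rewrite ffunE; case: ifP => vs; rewrite ?eqxx // mulf_eq0 (negPf (sg_neq0 _ _)). Qed.

Lemma restrE P c s : restr P c s = if P s then c s else 0.
Proof. by rewrite ffunE. Qed.

Lemma restr_supp P c s : restr P c s != 0 -> P s /\ c s != 0.
Proof. by rewrite restrE; case: ifP => // _; rewrite eqxx. Qed.

Lemma eq_bdry_at c (d : chain V) t : (forall w, w \notin t -> c (w |: t) = d (w |: t)) ->
  bdry c t = bdry d t.
Proof.
move=> e; rewrite !bdryE !sum_ffunE; apply: eq_bigr => w _; rewrite !ffunE.
by case: ifPn => // /e ->.
Qed.

(** At most one term of the boundary coefficient at [t] survives, and its sign is a unit. *)
Lemma bdry_eq0_unique c t w : w \notin t -> bdry c t = 0 ->
  (forall u, u \notin t -> c (u |: t) != 0 -> u = w) -> c (w |: t) = 0.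
Proof.
move=> wt /[swap] uq; rewrite bdryE sum_ffunE (bigD1 w) //= big1 ?addr0 => [|u uw].
  by rewrite ffunE (negPf wt) => /eqP; rewrite mulf_eq0 (negPf (sg_neq0 _ _)) => /eqP.
rewrite ffunE; case: ifPn => // ut; have [->|nz] := eqVneq (c (u |: t)) 0.
  by rewrite mulr0.
by rewrite (uq u ut nz) eqxx in uw.
Qed.

Lemma supportedD P c (d : chain V) : supported P c -> supported P d -> supported P (c + d).
Proof.
move=> cP dP s; rewrite ffunE; have [->|/cP//] := eqVneq (c s) 0.
by rewrite add0r; apply: dP.
Qed.

Lemma sum_supp (T : finType) (f : T -> chain V) s :
  (\sum_l f l) s != 0 -> exists l, f l s != 0.
Proof.
rewrite sum_ffunE => nz; apply/existsP; apply: contra_neqT nz => /existsPn z.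
by rewrite big1 // => l _; apply/eqP; rewrite -[_ == _]negbK z.
Qed.

(* Coning off the part of [c] with label [l] from the apex [u l] replaces it by
   the cone over its boundary; the part without label is left alone. *)
Lemma cone_off (T : finType) (lab : {set V} -> option T) (u : T -> V) c :
  exists b : chain V,
    (forall s, b s != 0 ->
      exists l r, [/\ s = u l |: r, lab r = Some l & c r != 0]) /\
    (forall s, (c - bdry b) s != 0 -> (lab s = None /\ c s != 0) \/
      exists l r, [/\ s = u l |: r, u l \notin r &
        bdry (restr (fun r => lab r == Some l) c) r != 0]).
Proof.
pose cl l := restr (fun r => lab r == Some l) c.
exists (\sum_l cone (u l) (cl l)); split=> [s|s].
  move=> /sum_supp[l /cone_supp[us /restr_supp[/eqP lr cr]]].
  by exists l, (s :\ u l); rewrite setD1K.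
have -> : c - bdry (\sum_l cone (u l) (cl l)) =
    restr (fun r => lab r == None) c + \sum_l cone (u l) (bdry (cl l)).
  rewrite raddf_sum /=; under eq_bigr do rewrite bdry_cone.
  rewrite sumrB opprB addrCA addrC; congr (_ + _).
  apply/ffunP => r; rewrite !ffunE sum_ffunE.
  case E : (lab r) => [l|]; last first.
    by rewrite eqxx big1 ?subr0 // => l _; rewrite restrE E.
  rewrite (bigD1 l) //= restrE E eqxx big1 ?addr0 ?subrr // => l' ll'.
  by rewrite restrE E (inj_eq Some_inj) eq_sym (negPf ll').
rewrite ffunE; set c0 := restr _ _; have [->|] := eqVneq (c0 s) 0; last first.
  by move=> /restr_supp[/eqP E cs] _; left.
rewrite add0r => /sum_supp[l /cone_supp[us nz]]; right.
by exists l, (s :\ u l); rewrite setD1K // !inE eqxx.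
Qed.

(** Vertices are replaced one at a time: the simplices through [y] are coned off from [p y]. As the
    chain is a cycle, the boundary of that part lies in the link of [y], so [p y] takes the place of
    [y]. Idempotence of [p] keeps treated vertices from coming back. *)
Lemma fold_cycle (F : {set V} -> Prop) (p : V -> V) c :
  (forall s t, F s -> t \subset s -> F t) ->
  (forall s x, F s -> x \in s -> F (p x |: s)) ->
  (forall x, p (p x) = p x) ->
  supported F c -> bdry c = 0 ->
  exists b, supported F b /\
    supported (fun s => F s /\ forall x, x \in s -> p x = x) (c - bdry b).
Proof.
move=> Fsub Fp pp Fc cyc.
suff H (l : seq V) : exists b, supported F b /\
    supported (fun s => F s /\ forall x, x \in s -> x \in l -> p x = x) (c - bdry b).
  have [b [Fb Hb]] := H (enum V); exists b; split=> // s /Hb[Fs Hs].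
  by split=> // x xs; apply: Hs; rewrite ?mem_enum.
elim: l => [|y l [b [Fb Hb]]].
  by exists 0; split=> s; [rewrite ffunE eqxx|rewrite raddf0 subr0 => /Fc].
have [py|py] := eqVneq (p y) y.
  exists b; split=> // s /Hb[Fs Hs]; split=> // x xs.
  by rewrite inE => /predU1P[->//|]; apply: Hs.
pose lab (s : {set V}) := if y \in s then Some tt else None.
have [b' [Hb1 Hb2]] := cone_off lab (fun=> p y) (c - bdry b).
exists (b + b'); rewrite raddfD opprD addrA; split.
  apply: supportedD => // s /Hb1[[] [r [-> + /Hb[Fr _]]]].
  by rewrite /lab; case: ifP => // yr _; apply: Fp.
have cyc' : bdry (c - bdry b) = 0 by rewrite raddfB /= cyc bdry_bdry subrr.
move=> s /Hb2[[]|[[] [r [-> pr nz]]]].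
  rewrite /lab; case: ifPn => // ys _ /Hb[Fs Hs]; split=> // x xs.
  by rewrite inE => /predU1P[xy|]; [rewrite -xy xs in ys | apply: Hs].
(* A face through [y] has all its cofaces in the labelled part, so the boundary there is that of the
   whole cycle. *)
have yr : y \notin r.
  apply/negP => yr; move: nz; rewrite (@eq_bdry_at _ (c - bdry b)) ?cyc' ?ffunE ?eqxx //.
  by move=> w _; rewrite restrE /lab !inE yr orbT eqxx.
have [w wr] := bdry_supp nz.
move=> /restr_supp[]; rewrite /lab !inE (negPf yr) orbF.
case: (eqVneq y w) => // <- _ /Hb[Fyr Hyr]; split.
  apply: (Fsub _ _ (Fp _ y Fyr _)); first by rewrite !inE eqxx.
  by rewrite setUS // subsetUr.
move=> x; rewrite !inE => /orP[/eqP->|xr]; first by rewrite pp.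
move=> /predU1P[xy|]; first by rewrite -xy xr in yr.
by apply: Hyr; rewrite !inE xr orbT.
Qed.

(** Fillings are built without tracking sizes. Only simplices with [m.+1] vertices have facets with
    [m] vertices, so the others can be discarded. *)
Lemma bdry_restr_card c (d : chain V) m : bdry c = d -> supported (fun s => #|s| = m) d ->
  bdry (restr (fun s => #|s| == m.+1) c) = d.
Proof.
move=> <- cm; apply/ffunP => t; have [tm|tm] := eqVneq #|t| m.
  apply: eq_bdry_at => w wt; rewrite restrE cardsU1 wt tm eqxx //.
have -> : bdry c t = 0.
  by apply/eqP; apply: contraNT tm => /cm /eqP.
apply/eqP; apply: contraT => /bdry_supp[w wt /restr_supp[]].
by rewrite cardsU1 wt add1n eqSS (negPf tm).
Qed.

End ChainOperators.

(** * Simplices of the cube complex and high degrees *)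

Section CubeNeighbours.
Variable n : nat.
Implicit Types (v w x y a b : hypercube_vertex n) (s t : {set hypercube_vertex n}).

Local Notation vtx := (hypercube_vertex n).
Local Notation adj := (@hypercube_adj n).

Definition flip v (k : 'I_n) : vtx := [ffun i => v i (+) (i == k)].

Definition parity v := \big[addb/false]_i v i.

Definition ball v : {set vtx} := [set x | (x == v) || adj v x].

Definition in_edge_nbhd a b s := [forall x in s, adj a x || adj b x].

Lemma flipK v k : flip (flip v k) k = v.
Proof. by apply/ffunP => i; rewrite !ffunE -addbA addbb addbF. Qed.

Lemma flipC v k l : flip (flip v k) l = flip (flip v l) k.
Proof. by apply/ffunP => i; rewrite !ffunE -!addbA (addbC (i == k)). Qed.

Lemma adjP x y : reflect (exists k, y = flip x k) (adj x y).
Proof.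
apply: (iffP cards1P) => -[k xy]; exists k.
  apply/ffunP => i; move/setP/(_ i): xy; rewrite !inE ffunE.
  by case: (x i) (y i) (i == k) => [] [] [].
by apply/setP => i; rewrite xy !inE ffunE; case: (x i) (i == k) => [] [].
Qed.

Lemma adj_flip v k : adj v (flip v k).
Proof. by apply/adjP; exists k. Qed.

Lemma adjC x y : adj x y = adj y x.
Proof. exact: hypercube_adj_sym. Qed.

Lemma parity_flip v k : parity (flip v k) = ~~ parity v.
Proof.
rewrite /parity; under eq_bigr do rewrite ffunE.
rewrite big_split /= -addbT; congr (_ (+) _).
by rewrite (bigD1 k) //= eqxx big1 // => i /negPf.
Qed.

Lemma parity_adj x y : adj x y -> parity y = ~~ parity x.
Proof. by move=> /adjP[k ->]; rewrite parity_flip. Qed.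

Lemma flip_common v j k l m : flip v j = flip (flip (flip v k) l) m ->
  k != l -> j = k \/ j = l.
Proof.
move=> e kl; have [->|jk] := eqVneq j k; first by left.
have [->|jl] := eqVneq j l; [by right|exfalso].
move/ffunP: e => e; have := e j; have := e k; rewrite !ffunE !eqxx.
rewrite (negPf jk) (negPf jl) (negPf kl) (eq_sym k j) (negPf jk).
case: (eqVneq k m) => [km _|_]; last by case: (v k).
by rewrite -km (negPf jk); case: (v j).
Qed.

(** If there is a common neighbour, [v] and [w] differ by two flips, and a path of length 2 performs
    these in one of two orders. *)
Lemma card_common_nbrs v w : v != w -> (#|[set x | adj v x && adj w x]| <= 2)%N.
Proof.
move=> vw; have [->|[x0]] := set_0Vmem [set x | adj v x && adj w x].
  by rewrite cards0.
rewrite inE => /andP[/adjP[j vx] /adjP[k wx]].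
have wE : w = flip (flip v j) k by rewrite -vx wx flipK.
have jk : j != k by apply: contraNneq vw => jk; rewrite wE jk flipK.
apply: leq_trans (_ : #|[set flip v j; flip v k]| <= 2)%N; last by rewrite cards2; lia.
apply/subset_leq_card/subsetP => x; rewrite !inE => /andP[/adjP[i ->] /adjP[m]].
by rewrite wE => /flip_common/(_ jk)[]->; rewrite eqxx ?orbT.
Qed.

Lemma in_ball v x : (x \in ball v) = (x == v) || adj v x.
Proof. by rewrite inE. Qed.

(** The cube is bipartite: centres of equal parity share only common neighbours, centres of opposite
    parity at most the centres themselves. *)
Lemma card_ballI v w : v != w -> (#|ball v :&: ball w| <= 2)%N.
Proof.
move=> vw; have [pvw|pvw] := eqVneq (parity v) (parity w).
  apply: leq_trans (card_common_nbrs vw).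
  apply/subset_leq_card/subsetP => x; rewrite !inE => /andP[].
  move=> /predU1P[->|vx] /predU1P[xw|wx]; rewrite ?vx ?wx //.
  - by rewrite xw eqxx in vw.
  - by move: (parity_adj wx); rewrite pvw; case: (parity w).
  - by move: (parity_adj vx); rewrite xw pvw; case: (parity w).
apply: leq_trans (_ : #|[set v; w]| <= 2)%N; last by rewrite cards2; lia.
apply/subset_leq_card/subsetP => x; rewrite !inE => /andP[].
move=> /predU1P[->|vx] /predU1P[xw|wx]; rewrite ?eqxx ?xw ?eqxx ?orbT //.
by move: pvw; rewrite -(inj_eq negb_inj) -(parity_adj vx) -(parity_adj wx) eqxx.
Qed.

Lemma in_edge_nbhdP a b s :
  reflect (forall x, x \in s -> adj a x || adj b x) (in_edge_nbhd a b s).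
Proof. exact: forall_inP. Qed.

Lemma in_edge_nbhdC a b s : in_edge_nbhd a b s = in_edge_nbhd b a s.
Proof. by apply: eq_forallb_in => x _; rewrite orbC. Qed.

Lemma in_edge_nbhdS a b s t : in_edge_nbhd a b s -> t \subset s -> in_edge_nbhd a b t.
Proof. by move=> /in_edge_nbhdP h /subsetP ts; apply/in_edge_nbhdP => x /ts/h. Qed.

(* An edge is recorded as the pair of its even and its odd end. *)
Definition covers (e : vtx * vtx) s :=
  [&& adj e.1 e.2, ~~ parity e.1 & in_edge_nbhd e.1 e.2 s].

Definition cube_face s := [exists e, covers e s].

Lemma coversS e s t : covers e s -> t \subset s -> covers e t.
Proof. by move=> /and3P[ab pa h] ts; rewrite /covers ab pa (in_edge_nbhdS h). Qed.

Lemma covers_odd e s : covers e s -> parity e.2.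
Proof. by move=> /and3P[/parity_adj -> ->]. Qed.

Lemma covers_odd_part e s x : covers e s -> x \in s -> parity x -> adj e.1 x.
Proof.
move=> es xs px; have /and3P[_ _ /in_edge_nbhdP/(_ x xs)/orP[//|]] := es.
by move=> /parity_adj; rewrite px (covers_odd es).
Qed.

Lemma covers_even_part e s x : covers e s -> x \in s -> ~~ parity x -> adj e.2 x.
Proof.
move=> /and3P[_ pa /in_edge_nbhdP h] /h /orP[|//].
by move=> /parity_adj ->; rewrite (negPf pa).
Qed.

Lemma coversU1 e s x : covers e s -> adj e.1 x || adj e.2 x -> covers e (x |: s).
Proof.
move=> /and3P[ab pa /in_edge_nbhdP h] hx; rewrite /covers ab pa /=.
by apply/in_edge_nbhdP => y; rewrite !inE => /predU1P[->//|/h].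
Qed.

Lemma cube_faceP s : reflect
  (exists a b, adj a b /\ forall x, x \in s -> adj a x || adj b x) (cube_face s).
Proof.
apply: (iffP existsP) => [[[a b] /and3P[ab _ /in_edge_nbhdP h]]|[a [b [ab h]]]].
  by exists a, b.
case pa : (parity a); last by exists (a, b); rewrite /covers ab pa; apply/in_edge_nbhdP.
exists (b, a); rewrite /covers /= adjC ab (parity_adj ab) pa.
by rewrite in_edge_nbhdC; apply/in_edge_nbhdP.
Qed.

End CubeNeighbours.

(** * Vanishing in degrees at least 5 *)

Section HighDegrees.
Variable n : nat.
Local Notation vtx := (hypercube_vertex n).
Local Notation adj := (@hypercube_adj n).
Implicit Types (v w x y a b : vtx) (s t : {set vtx}) (e : vtx * vtx).

Definition centred v s := (#|s :\: ball v| <= 1)%N.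

Definition near_star e s := covers e s && (centred e.1 s || centred e.2 s).

Lemma centredS v s t : centred v s -> t \subset s -> centred v t.
Proof. by move=> vs ts; apply: leq_trans vs; apply/subset_leq_card/setSD. Qed.

Lemma centredU1 v s x : centred v s -> x \in ball v -> centred v (x |: s).
Proof.
move=> vs xv; rewrite /centred setDUl (_ : [set x] :\: ball v = set0) ?set0U //.
by apply/eqP; rewrite setD_eq0 sub1set.
Qed.

(** For distinct centres, two vertices in both balls and one exception per centre give at most four
    vertices. *)
Lemma centre_unique v w s : centred v s -> centred w s -> (5 <= #|s|)%N -> v = w.
Proof.
move=> vs ws s5; apply/eqP; apply: contraLR s5 => /card_ballI vw; rewrite -ltnNge.
have := cardsID (ball v) s; have := cardsID (ball w) (s :&: ball v).
have : (#|(s :&: ball v) :&: ball w| <= 2)%N.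
  by apply: leq_trans vw; apply/subset_leq_card; rewrite -setIA subsetIr.
have : (#|(s :&: ball v) :\: ball w| <= 1)%N.
  by apply: leq_trans ws; apply/subset_leq_card/setSD/subsetIl.
by move: vs; rewrite /centred; lia.
Qed.

Lemma near_starS e s t : near_star e s -> t \subset s -> near_star e t.
Proof.
move=> /andP[es c] ts; rewrite /near_star (coversS es ts) /=.
by case/orP: c => /centredS/(_ ts) ->; rewrite ?orbT.
Qed.

(* The odd (even) part of the neighbourhood of an edge is the open
   neighbourhood of its even (odd) end, and two distinct open neighbourhoods
   share at most two vertices. *)
Lemma two_covers e f s : covers e s -> covers f s -> e != f -> (5 <= #|s|)%N ->
  near_star e s.
Proof.
case: e f => [a b] [c d] es fs; rewrite xpair_eqE negb_and /near_star es /= => ef s5.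
pose so := [set x in s | parity x]; pose se := [set x in s | ~~ parity x].
have cardE : #|s| = (#|so| + #|se|)%N.
  rewrite -(cardsID [set x | parity x] s); congr (_ + _)%N; apply: eq_card => x.
    by rewrite !inE.
  by rewrite !inE andbC.
have odd_le : a != c -> (#|so| <= 2)%N.
  move=> ac; apply: leq_trans (card_common_nbrs ac).
  apply/subset_leq_card/subsetP => x; rewrite !inE => /andP[xs px].
  by rewrite (covers_odd_part es xs px) (covers_odd_part fs xs px).
have even_le : b != d -> (#|se| <= 2)%N.
  move=> bd; apply: leq_trans (card_common_nbrs bd).
  apply/subset_leq_card/subsetP => x; rewrite !inE => /andP[xs px].
  by rewrite (covers_even_part es xs px) (covers_even_part fs xs px).
have /and3P[ab pa _] := es; have /and3P[cd pc _] := fs; rewrite /= in ab pa cd pc.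
have [ac|ac] := eqVneq a c; last first.
  have [bd|bd] := eqVneq b d; last first.
    by move: s5; rewrite cardE => /leq_trans/(_ (leq_add (odd_le ac) (even_le bd))).
  (* Now [b = d]. A vertex of [s] outside the ball of [b] is odd, hence a common neighbour of [a]
     and [c]; of these there are at most two, and [b] is one. *)
  apply/orP; right; apply: leq_trans (_ : #|[set x | adj a x && adj c x] :\ b| <= 1)%N; last first.
    have := card_common_nbrs ac.
    by rewrite (cardsD1 b) !inE ab bd cd.
  apply/subset_leq_card/subsetP => x; rewrite !inE negb_or => /andP[/andP[xb bx] xs].
  case px: (parity x).
    by rewrite xb (covers_odd_part es xs px) (covers_odd_part fs xs px).
  by rewrite (covers_even_part es xs (negbT px)) in bx.
have bd : b != d by move: ef; rewrite ac eqxx.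
apply/orP; left.
apply: leq_trans (_ : #|[set x | adj b x && adj d x] :\ a| <= 1)%N; last first.
  have := card_common_nbrs bd.
  by rewrite (cardsD1 a) !inE ac adjC -ac ab ac adjC cd.
apply/subset_leq_card/subsetP => x; rewrite !inE negb_or => /andP[/andP[xa ax] xs].
case px: (parity x).
  by rewrite (covers_odd_part es xs px) in ax.
by rewrite xa (covers_even_part es xs (negbT px)) (covers_even_part fs xs (negbT px)).
Qed.

Definition near_some_star s := [exists e, near_star e s].

Lemma near_star_covers e s : near_some_star s -> covers e s -> (5 <= #|s|)%N ->
  near_star e s.
Proof.
move=> /existsP[f fs] es s5; have [->//|ef] := eqVneq e f.
by case/andP: fs => fs _; apply: two_covers es fs ef s5.
Qed.

Lemma near_some_starS s t : near_some_star s -> t \subset s -> near_some_star t.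
Proof. by move=> /existsP[e es] ts; apply/existsP; exists e; apply: near_starS es ts. Qed.

(** Simplices that are not near stars are coned off from the even end of a chosen edge. As [m >= 6],
    facets have at least five vertices, so one that is not a near star has at most one carrying
    edge, and the boundary of each labelled part vanishes on it. *)
Lemma cycle_to_near_stars (c : chain vtx) m : (6 <= m)%N -> bdry c = 0 ->
  supported (fun s => cube_face s /\ #|s| = m) c ->
  exists b : chain vtx, supported (fun s => cube_face s) b /\
    supported (fun s => near_some_star s /\ #|s| = m) (c - bdry b).
Proof.
move=> m6 cyc cK.
pose lab s := if near_some_star s then None else [pick e | covers e s].
have labE s e : lab s = Some e -> ~~ near_some_star s /\ covers e s.
  by rewrite /lab; case: ifP => // _; case: pickP => // f fs [<-].
have [b [b1 b2]] := cone_off lab (fun e => e.1) c.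
exists b; split=> [s /b1[e [r [-> /labE[_ er] _]]]|s /b2[[ls cs]|[e [r [-> er nz]]]]].
- apply/existsP; exists e; apply: coversU1 => //.
  by case/and3P: er => [ab _ _]; rewrite (adjC e.2) ab orbT.
- have [/existsP[e es] sm] := cK _ cs; split=> //; move: ls; rewrite /lab.
  by case: ifP => // _; case: pickP => // /(_ e); rewrite es.
have [w wr /restr_supp[/eqP/labE[_ ewr] /cK[_ cwr]]] := bdry_supp nz.
have rm : #|r| = m.-1 by move: cwr; rewrite cardsU1 wr; lia.
have cer : covers e r by apply: coversS ewr (subsetUr _ _).
have nr : near_some_star r.
  apply: contraT => nr; move: nz; rewrite (@eq_bdry_at _ _ c) ?cyc ?ffunE ?eqxx //.
  move=> u ur; rewrite restrE; have [->|/cK[/existsP[f fu] _]] := eqVneq (c (u |: r)) 0.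
    by case: ifP.
  have /negPf nur : ~~ near_some_star (u |: r).
    by apply: contra nr => h; apply: near_some_starS h (subsetUr _ _).
  rewrite /lab nur.
  case: pickP => [g gu|/(_ f)]; last by rewrite fu.
  have [->|ge] := eqVneq g e; first by rewrite eqxx.
  case/negP: nr; apply/existsP; exists g.
  apply: two_covers (coversS gu (subsetUr _ _)) cer ge _; lia.
have /andP[_ cc] : near_star e r by apply: near_star_covers => //; lia.
have /and3P[ab _ _] := cer.
split; last by rewrite cardsU1 er rm; lia.
apply/existsP; exists e; rewrite /near_star coversU1 ?(adjC e.2) ?ab ?orbT //=.
(* The apex [e.1] lies in the closed balls of both ends, so it adds no exception. *)
case/orP: cc => /centredU1 ->; rewrite ?orbT // in_ball ?eqxx //.
by rewrite adjC ab orbT.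
Qed.

(** The label is now the centre. Facets have at least five vertices, so simplices of the cycle that
    share a facet have the same centre; the part with a given centre is itself a cycle and bounds
    its cone. *)
Lemma near_stars_cycle_bounds (c : chain vtx) m : (6 <= m)%N -> bdry c = 0 ->
  supported (fun s => near_some_star s /\ #|s| = m) c ->
  exists2 b : chain vtx, supported (fun s => cube_face s) b & bdry b = c.
Proof.
move=> m6 cyc cY.
(* The centre has to be an end of a carrying edge for the cone from it to stay in the complex. *)
pose cent v s := [exists e, near_star e s && ((v == e.1) || (v == e.2)) && centred v s].
pose lab s := [pick v | cent v s].
have labE s v : lab s = Some v -> cent v s.
  by rewrite /lab; case: pickP => // w ws [<-].
have [b [b1 b2]] := cone_off lab id c.
exists b => [s /b1[v [r [-> /labE/existsP[e /andP[/andP[/andP[er _] ve] _]] _]]]|].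
  apply/existsP; exists e; apply: coversU1 => //; case/and3P: er => [ab _ _].
  by case/orP: ve => /eqP->; rewrite ?ab // adjC ab orbT.
apply/esym/eqP; rewrite -subr_eq0; apply/eqP/ffunP => s; rewrite [RHS]ffunE.
apply/eqP; apply: contraT => /b2[[ls cs]|[v [r [_ vr nz]]]].
  have [/existsP[e /andP[es cc]] _] := cY _ cs.
  move: ls; rewrite /lab; case: pickP => // no _.
  case/orP: cc => cc; [move: (no e.1)|move: (no e.2)] => /negbT/existsPn/(_ e);
    by rewrite /near_star es cc eqxx ?orbT.
have [w wr /restr_supp[/eqP/labE/existsP[_ /andP[_ vwr]] /cY[_ cwr]]] := bdry_supp nz.
have rm : #|r| = m.-1 by move: cwr; rewrite cardsU1 wr; lia.
have cr := centredS vwr (subsetUr _ _).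
move: nz; rewrite (@eq_bdry_at _ _ c) ?cyc ?ffunE ?eqxx // => u ur; rewrite restrE.
have [->|/cY[/existsP[e /andP[es cc]] _]] := eqVneq (c (u |: r)) 0; first by case: ifP.
rewrite /lab; case: pickP => [x /existsP[_ /andP[_ xu]]|no].
  by rewrite (centre_unique (centredS xu (subsetUr _ _)) cr) ?eqxx //; lia.
case/orP: cc => cc; [move: (no e.1)|move: (no e.2)] => /negbT/existsPn/(_ e);
  by rewrite /near_star es cc eqxx ?orbT.
Qed.

Lemma high_cycle_bounds (c : chain vtx) m : (6 <= m)%N -> bdry c = 0 ->
  supported (fun s => cube_face s /\ #|s| = m) c ->
  exists2 b : chain vtx, supported (fun s => cube_face s) b & bdry b = c.
Proof.
move=> m6 cyc cK; have [b [bK bY]] := cycle_to_near_stars m6 cyc cK.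
have [|d dK dE] := near_stars_cycle_bounds m6 _ bY.
  by rewrite raddfB /= cyc bdry_bdry subr0.
by exists (b + d); [apply: supportedD|rewrite raddfD /= dE addrC subrK].
Qed.

End HighDegrees.

(** * Low degrees *)

Section LowDegrees.
Variable n : nat.
Local Notation vtx := (hypercube_vertex n).
Local Notation adj := (@hypercube_adj n).
Implicit Types (v w x y a b : vtx) (s t r : {set vtx}) (e : vtx * vtx).

Definition in_star s := [exists v, s \subset ball v].

Lemma in_star_nbrs v s : (forall x, x \in s -> adj v x) -> in_star s.
Proof.
by move=> h; apply/existsP; exists v; apply/subsetP => x /h; rewrite in_ball orbC => ->.
Qed.

Lemma covers_center e s : covers e s -> covers e (e.2 |: s).
Proof. by move=> es; apply: coversU1 => //; case/and3P: es => ->. Qed.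

(* The vertices of a path x, a, b, y without the even vertex [a]. *)
Definition bent_path (p : vtx * vtx * vtx) s := let: (b, x, y) := p in
  [&& s == [set b; x; y], parity b, parity x, ~~ parity y, adj b y
    & [exists a, adj a b && adj a x]].

Lemma bent_path_covers b x y s : bent_path (b, x, y) s ->
  exists2 a, covers (a, b) s & adj a x.
Proof.
move=> /and5P[/eqP-> pb px py /andP[bY /existsP[a /andP[ab ax]]]]; exists a => //.
rewrite /covers /= ab -(parity_adj ab) pb /=.
apply/in_edge_nbhdP => z; rewrite !inE => /orP[/orP[]|] /eqP->.
- by rewrite ab.
- by rewrite ax.
- by rewrite bY orbT.
Qed.

(** Coning from the odd end [b] of an edge [ab] leaves simplices made of [b] and a face [r] of at
    most two vertices. If [r] lies in N(a) or in N(b), this is a star; otherwise [r] has one vertex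
    next to [a] only and one next to [b] only. *)
Lemma cycle_to_bent_paths (c : chain vtx) m : (m <= 3)%N ->
  supported (fun s => cube_face s /\ #|s| = m) c ->
  exists b : chain vtx, supported (fun s => cube_face s) b /\
    supported (fun s => #|s| = m /\
      (in_star s \/ m = 3%N /\ exists p, bent_path p s)) (c - bdry b).
Proof.
move=> m3 cK.
pose lab s := if in_star s then None else [pick e | covers e s].
have labE s e : lab s = Some e -> covers e s.
  by rewrite /lab; case: ifP => // _; case: pickP => // f fs [<-].
have [b [b1 b2]] := cone_off lab (fun e => e.2) c.
exists b; split=> [s /b1[e [r [-> /labE er _]]]|s /b2[[ls cs]|[e [r [-> er nz]]]]].
- by apply/existsP; exists e; apply: covers_center.
- have [/existsP[e es] sm] := cK _ cs; split=> //; left; move: ls; rewrite /lab.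
  by case: ifP => // _; case: pickP => // /(_ e); rewrite es.
have [w wr /restr_supp[/eqP/labE ewr /cK[_ cwr]]] := bdry_supp nz.
have cer : covers e r by apply: coversS ewr (subsetUr _ _).
have rm : m = #|r|.+1 by move: cwr; rewrite cardsU1 wr; lia.
split; first by rewrite cardsU1 er rm.
have /and3P[ab pa /in_edge_nbhdP h] := cer.
have [ha|] := boolP [forall x in r, adj e.1 x].
  left; apply: (@in_star_nbrs e.1) => x; rewrite !inE => /predU1P[->//|].
  exact: (forall_inP ha).
rewrite negb_forall_in => /exists_inP[y yr ay].
have bY : adj e.2 y by move: (h y yr); rewrite (negPf ay).
have [hb|] := boolP [forall x in r, adj e.2 x].
  left; apply/existsP; exists e.2; apply/subsetP => x; rewrite !inE.
  by move=> /predU1P[->|/(forall_inP hb) ->]; rewrite ?eqxx ?orbT.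
rewrite negb_forall_in => /exists_inP[x xr bx].
have ax : adj e.1 x by move: (h x xr); rewrite (negPf bx) orbF.
have xy : x != y by apply: contraNneq ay => <-.
have rE : r = [set x; y].
  apply/esym/eqP; rewrite eqEcard; apply/andP; split.
    by apply/subsetP => z; rewrite !inE => /orP[]/eqP->.
  by rewrite cards2 xy -ltnS -rm.
right; split; first by rewrite rm rE cards2 xy.
exists (e.2, x, y); rewrite /bent_path rE setUA eqxx bY (parity_adj ax) pa.
rewrite (parity_adj bY) negbK (covers_odd cer) /=.
by apply/existsP; exists e.1; rewrite ab ax.
Qed.

(** The choice depends on the ends alone, so bent paths with equal ends are moved to the same
    triangle. The default [y] is never taken at the ends of a bent path. *)
Definition via x y := odflt y [pick b | adj b y && [exists a, adj a b && adj a x]].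

Lemma viaP b x y s : bent_path (b, x, y) s ->
  adj (via x y) y /\ exists2 a, adj a (via x y) & adj a x.
Proof.
move=> /and5P[_ _ _ _ h]; rewrite /via; case: pickP => [b'|/(_ b)]; last by rewrite h.
by move=> /andP[-> /existsP[a /andP[? ?]]]; split=> //; exists a.
Qed.

(* [x] is antipodal to [y] in a 3-cube; two vertices at distance 1 from [y] in
   that cube have a common neighbour next to [x]. *)
Lemma common_nbr b d x y a a' : adj b y -> adj d y -> b != d -> ~~ adj x y ->
  adj a b -> adj a x -> adj a' d -> adj a' x ->
  exists a0, [/\ adj a0 b, adj a0 d & adj a0 x].
Proof.
rewrite (adjC b y) (adjC d y) (adjC x y) (adjC a b) (adjC a' d).
move=> /adjP[j ->] /adjP[k ->] jk nyx /adjP[p ->] /adjP[q xE].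
move=> /adjP[p' ->] /adjP[q' xE'].
have xy i : x <> flip y i by move=> xi; rewrite xi adj_flip in nyx.
have jk' : k != j by apply: contraNneq jk => ->.
have [kp'|kp'] := eqVneq k p'; first by case: (xy q'); rewrite xE' kp' flipK.
have [kq'|kq'] := eqVneq k q'; first by case: (xy p'); rewrite xE' kq' flipC flipK.
(* The path through [d] shows that [x] and [y] differ at [k], as undoing this flip would make them
   adjacent. So the path through [b] flips [k] too, and [y] with [j] and [k] flipped is the common
   neighbour. *)
have : k = p \/ k = q.
  have [->|kp] := eqVneq k p; first by left.
  have [->|kq] := eqVneq k q; [by right|exfalso].
  move: (congr1 (fun z : vtx => z k) xE'); rewrite xE !ffunE eqxx.
  rewrite (negPf kp) (negPf kq) (negPf kp') (negPf kq') (negPf jk').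
  by case: (y k).
rewrite {}xE => {xE' xy nyx}.
case=> <-; exists (flip (flip y j) k); split.
- by rewrite adjC adj_flip.
- by rewrite flipC adjC adj_flip.
- exact: adj_flip.
- by rewrite adjC adj_flip.
- by rewrite flipC adjC adj_flip.
- by rewrite [flip (flip _ p) k]flipC adj_flip.
Qed.

(** Coning a bent path from [via x y] leaves stars and triangles determined by [x] and [y]. The edge
    [xy] of such a triangle lies in no other simplex of the new cycle, so the coefficient of the
    triangle vanishes. *)
Lemma bent_paths_to_stars (c : chain vtx) : bdry c = 0 ->
  supported (fun s => #|s| = 3%N /\ (in_star s \/ exists p, bent_path p s)) c ->
  exists b : chain vtx, supported (fun s => cube_face s) b /\
    supported (fun s => in_star s) (c - bdry b).
Proof.
move=> cyc cB.
pose lab s := if in_star s then None else [pick p | bent_path p s].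
have labE s p : lab s = Some p -> ~~ in_star s /\ bent_path p s.
  by rewrite /lab; case: ifP => // _; case: pickP => // q qs [<-].
have nonadj b x y s : ~~ in_star s -> bent_path (b, x, y) s -> ~~ adj x y.
  move=> ns /and5P[/eqP sE _ _ _ /andP[bY _]]; apply: contra ns => xy.
  apply/existsP; exists y; apply/subsetP => z; rewrite sE !inE.
  by move=> /orP[/orP[]|] /eqP->; rewrite ?eqxx // -?[adj y _]adjC ?[adj y _]adjC ?bY ?xy orbT.
have [b [b1 b2]] := cone_off lab (fun p => via p.1.2 p.2) c.
exists b; split=> [s /b1[[[d x] y] [r [-> /labE[nr dr] _]]]|].
  rewrite /=; have [vY [a' a'v a'x]] := viaP dr.
  have [a ar ax] := bent_path_covers dr.
  have [dv|dv] := eqVneq d (via x y).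
    by apply/existsP; exists (a, d); apply: coversU1 => //; rewrite -dv; case/and3P: ar => ->.
  have := dr => /and5P[/eqP rE pd _ _ /andP[dY _]].
  have ad : adj a d by case/and3P: ar.
  have [a0 [a0d a0v a0x]] := common_nbr dY vY dv (nonadj _ _ _ _ nr dr) ad ax a'v a'x.
  apply/cube_faceP; exists a0, d; split=> // z; rewrite rE !inE.
  by case/predU1P=> [->|/orP[/orP[]|] /eqP->]; rewrite ?a0v ?a0d ?a0x // dY orbT.
(* The cone over the face opposite the middle vertex is the canonical triangle; opposite [x] it is a
   star at [y], and opposite [y] a star at a common neighbour. *)
have canon s : (c - bdry b) s != 0 -> in_star s \/
    exists x y, [/\ s = via x y |: [set x; y], via x y \notin [set x; y], ~~ adj x y,
      parity x & ~~ parity y && adj (via x y) y].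
  move=> /b2[[ls /cB[_ [|[p ps]]]]|[[[d x] y] [r [-> /= vr nz]]]].
  - by left.
  - left; move: ls; rewrite /lab; case: ifP => // _.
    by case: pickP => // /(_ p); rewrite ps.
  have [w wr /restr_supp[/eqP/labE[nw dw] /cB[cw _]]] := bdry_supp nz.
  have [vY [a' a'v a'x]] := viaP dw; have nxy := nonadj _ _ _ _ nw dw.
  have [a aw ax] := bent_path_covers dw; have ad : adj a d by case/and3P: aw.
  have := dw => /and5P[/eqP rE pd px py /andP[dY _]].
  have rsub : r \subset [set d; x; y] by rewrite -rE subsetUr.
  have : w \in [set d; x; y] by rewrite -rE !inE eqxx.
  rewrite !inE => /orP[/orP[]|] /eqP wE.
  - right; exists x, y; rewrite nxy px py vY.
    have rxy : r = [set x; y].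
      apply/eqP; rewrite eqEcard; apply/andP; split.
        apply/subsetP => z zr; move/subsetP/(_ z zr): rsub; rewrite !inE -orbA.
        by case/predU1P=> [zd|//]; rewrite wE -zd zr in wr.
      by rewrite cards2; move: cw; rewrite cardsU1 wr add1n => -[->]; case: (x != y).
    by rewrite -rxy; split.
  - left; apply/existsP; exists y; apply/subsetP => z; rewrite !inE => /predU1P[->|zr].
      by rewrite adjC vY orbT.
    move/subsetP/(_ z zr): rsub; rewrite !inE => /orP[/orP[]|] /eqP zE.
    - by rewrite zE adjC dY orbT.
    - by rewrite wE -zE zr in wr.
    - by rewrite zE eqxx.
  - left; have [dv|dv] := eqVneq d (via x y).
      apply: (@in_star_nbrs a) => z; rewrite -dv !inE => /predU1P[->//|zr].
      move/subsetP/(_ z zr): rsub; rewrite !inE => /orP[/orP[]|] /eqP zE; rewrite ?zE //.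
      by rewrite wE -zE zr in wr.
    have [a0 [a0d a0v a0x]] := common_nbr dY vY dv nxy ad ax a'v a'x.
    apply: (@in_star_nbrs a0) => z; rewrite !inE => /predU1P[->//|zr].
    move/subsetP/(_ z zr): rsub; rewrite !inE => /orP[/orP[]|] /eqP zE; rewrite ?zE //.
    by rewrite wE -zE zr in wr.
have cyc' : bdry (c - bdry b) = 0 by rewrite raddfB /= cyc bdry_bdry subr0.
(* Two vertices of opposite parity in one star are adjacent, since one of them is the centre. *)
have long x y s : ~~ adj x y -> parity x -> ~~ parity y -> x \in s -> y \in s ->
    ~~ in_star s.
  move=> nxy px py xs ys; apply/negP => /existsP[v /subsetP sv].
  move: (sv x xs) (sv y ys); rewrite !inE => /predU1P[<-|vx] /predU1P[yv|vy].
  - by move: py; rewrite yv px.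
  - by rewrite vy in nxy.
  - by rewrite yv adjC vx in nxy.
  - by move: py; rewrite (parity_adj vy) -(parity_adj vx) px.
move=> s nz; have [//|[x [y [sE vr nxy px /andP[py vY]]]]] := canon s nz.
case/eqP: nz; rewrite sE; apply: bdry_eq0_unique => //; first by rewrite cyc' ffunE.
move=> u ur /canon[st|[x' [y' [uE _ _ px' /andP[py' vY']]]]].
  by move: st; apply/contraTeq => _; apply: (long x y); rewrite // !inE eqxx ?orbT.
have pv : parity (via x' y') by rewrite -[parity _]negbK -(parity_adj vY') .
have yy : y = y'.
  have : y \in u |: [set x; y] by rewrite !inE eqxx !orbT.
  rewrite uE !inE => /or3P[] /eqP yE //; first by rewrite yE pv in py.
  by rewrite yE px' in py.
subst y'.
have xx : x = x'.
  have : x \in u |: [set x; y] by rewrite !inE eqxx !orbT.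
  rewrite uE !inE => /or3P[] /eqP xE //; first by rewrite xE vY' in nxy.
  by rewrite xE (negPf py) in px.
subst x'; have : u \in via x y |: [set x; y] by rewrite -uE !inE eqxx.
by rewrite !inE => /orP[/eqP//|]; move: ur; rewrite !inE => /negPf->.
Qed.

Definition zero_below (j : nat) s :=
  in_star s /\ forall x (i : 'I_n), x \in s -> (i < j)%N -> x i = false.

(** A star at [v] lies in the neighbourhood of the edge at [v] in direction [k]. Flipping coordinate
    [k] exchanges the two halves of that neighbourhood, so clearing the coordinate vertex by vertex
    never leaves it. *)
Lemma fold_coordinate (c : chain vtx) (k : 'I_n) : bdry c = 0 ->
  supported (zero_below k) c ->
  exists b : chain vtx, supported (fun s => cube_face s) b /\
    supported (zero_below k.+1) (c - bdry b).
Proof.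
move=> cyc cZ.
pose F s := (exists v, in_edge_nbhd v (flip v k) s) /\
  forall x (i : 'I_n), x \in s -> (i < k)%N -> x i = false.
pose p x : vtx := [ffun i => if i == k then false else x i].
have pE x : p x = x \/ p x = flip x k.
  case xk : (x k); [right|left]; apply/ffunP => i; rewrite !ffunE.
    by case: eqP => [->|]; rewrite ?xk // addbF.
  by case: eqP => [->|//]; rewrite xk.
have [|||||b [bF bZ]] := @fold_cycle _ F p c.
- move=> s t [[v vs] Hs] ts; split; first by exists v; apply: in_edge_nbhdS vs ts.
  by move=> x i /(subsetP ts); apply: Hs.
- move=> s x [[v /in_edge_nbhdP vs] Hs] xs; split.
    exists v; apply/in_edge_nbhdP => y; rewrite !inE => /predU1P[->|/vs//].
    have [->|->] := pE x; first exact: vs.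
    have := vs x xs => /orP[] /adjP[i ->]; rewrite flipC.
      by rewrite adj_flip orbT.
    by rewrite flipK adj_flip.
  move=> y i; rewrite !inE => /predU1P[->|ys]; last exact: Hs.
  by move=> ik; rewrite ffunE; case: eqP => // _; apply: Hs.
- by move=> x; apply/ffunP => i; rewrite !ffunE; case: eqP.
- move=> s /cZ[/existsP[v /subsetP sv] Hs]; split=> //; exists v.
  apply/in_edge_nbhdP => x /sv; rewrite !inE => /predU1P[->|->//].
  by rewrite (adjC (flip _ _)) adj_flip orbT.
- exact: cyc.
exists b; split=> s.
  move=> /bF[[v vs] _]; apply/cube_faceP; exists v, (flip v k).
  by split; [exact: adj_flip|apply/in_edge_nbhdP].
move=> /bZ[[[v /in_edge_nbhdP vs] Hs] ps].
have zk x : x \in s -> x k = false by move=> /ps <-; rewrite ffunE eqxx.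
split; last first.
  move=> x i xs; rewrite ltnS leq_eqVlt => /predU1P[/ord_inj->|]; first exact: zk.
  exact: Hs.
(* Among the neighbours of [flip w k] only [w] has coordinate [k] cleared, so the folded simplex
   lies in the closed ball of [w]. *)
have star w : w k = false -> (forall x, x \in s -> adj w x || adj (flip w k) x) -> in_star s.
  move=> wk ws; apply/existsP; exists w; apply/subsetP => x xs; rewrite !inE.
  have /orP[->|/adjP[i xE]] := ws x xs; first by rewrite orbT.
  suff -> : x = w by rewrite eqxx.
  have [ik|ik] := eqVneq i k; first by rewrite xE ik flipK.
  have := zk x xs; rewrite xE !ffunE wk eqxx eq_sym (negPf ik) //.
case vk : (v k); last by apply: (star v).
apply: (star (flip v k)); first by rewrite ffunE vk eqxx.
by move=> x /vs; rewrite flipK orbC.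
Qed.

Lemma star_cycle_bounds (c : chain vtx) : (0 < n)%N -> bdry c = 0 ->
  supported (fun s => in_star s) c ->
  exists2 b : chain vtx, supported (fun s => cube_face s) b & bdry b = c.
Proof.
move=> n0 cyc cS.
have fold j : (j <= n)%N -> exists b : chain vtx,
    supported (fun s => cube_face s) b /\ supported (zero_below j) (c - bdry b).
  elim: j => [_|j IH jn].
    by exists 0; split=> s; [rewrite ffunE eqxx|rewrite raddf0 subr0 => /cS].
  have [b [bK bZ]] := IH (ltnW jn).
  have [|d [dK dZ]] := @fold_coordinate (c - bdry b) (Ordinal jn) _ bZ.
    by rewrite raddfB /= cyc bdry_bdry subr0.
  by exists (b + d); rewrite raddfD opprD addrA; split=> //; apply: supportedD.
have [b [bK bZ]] := fold n (leqnn n).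
pose o : vtx := [ffun=> false].
have sub s : (c - bdry b) s != 0 -> s \subset [set o].
  move=> /bZ[_ Hs]; apply/subsetP => x xs; rewrite inE; apply/eqP/ffunP => i.
  by rewrite ffunE; apply: Hs.
(* What is left is carried by the origin and the empty simplex, and the cone from the origin fills
   it. *)
exists (b + cone o (c - bdry b)).
  apply: supportedD => // s /cone_supp[os /sub so].
  apply/cube_faceP; exists (flip o (Ordinal n0)), o; rewrite adjC adj_flip; split=> // x xs.
  have [->|xo] := eqVneq x o; first by rewrite adjC adj_flip.
  by move/subsetP/(_ x): so; rewrite !inE xo xs => /(_ isT); rewrite (negPf xo).
rewrite raddfD /= bdry_cone [bdry (c - _)]raddfB /= cyc bdry_bdry subr0 raddf0 subr0.
by rewrite addrC subrK.
Qed.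

Lemma low_cycle_bounds (c : chain vtx) m : (0 < n)%N -> (m <= 3)%N -> bdry c = 0 ->
  supported (fun s => cube_face s /\ #|s| = m) c ->
  exists2 b : chain vtx, supported (fun s => cube_face s) b & bdry b = c.
Proof.
move=> n0 m3 cyc cK; have [b [bK bB]] := cycle_to_bent_paths m3 cK.
have cyc' : bdry (c - bdry b) = 0 by rewrite raddfB /= cyc bdry_bdry subr0.
have [d [dK dS]] : exists d : chain vtx, supported (fun s => cube_face s) d /\
    supported (fun s => in_star s) (c - bdry b - bdry d).
  have [m3'|m3'] := eqVneq m 3%N.
    apply: bent_paths_to_stars => // s /bB; rewrite m3' => -[-> h]; split=> //.
    by case: h => [|[]]; [left|right].
  exists 0; split=> s; first by rewrite ffunE eqxx.
  by rewrite raddf0 subr0 => /bB[_ [//|[/eqP]]]; rewrite (negPf m3').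
have [||f fK fE] := @star_cycle_bounds (c - bdry b - bdry d) n0 => //.
  by rewrite raddfB /= cyc' bdry_bdry subr0.
exists (b + d + f); first by do 2?apply: supportedD.
by rewrite !raddfD /= fE addrC -[c - _ - _]addrA -opprD subrK.
Qed.

End LowDegrees.

(** * Homology classes and the shape of the Čech complex *)

Section HomologyClasses.
Variables (V : finType) (K : simplicial_complex V) (i : int).

Lemma homology_neq0P : (exists h : reduced_homology K i, h != 0) <->
  exists2 c : chain V, c \in cycles K i &
    ~ exists2 b, b \in chains K (i + 1) & bdry b = c.
Proof.
have pi0 (z : cycle K i) :
    (\pi_(reduced_homology K i)%qT z == 0) = (z \in @boundaries V K i).
  by rewrite -[z in RHS]subr0 Quotient.idealrBE -pi_zeror.
split=> [[h]|[c cC cB]].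
  rewrite -[h]reprK pi0; case: (repr h) => c cC nb; exists c => // -[b bC bc].
  by case/negP: nb; apply/asboolP; exists b.
exists (\pi_(reduced_homology K i)%qT (Cycle cC)); rewrite pi0.
by apply/negP => /asboolP.
Qed.

End HomologyClasses.

(** * The Čech complex at scale 3 in terms of edge neighbourhoods *)

Section EdgeBalls.
Variables (R : realType) (n : nat).
Local Notation vtx := (hypercube_vertex n).
Local Notation adj := (@hypercube_adj n).
Local Notation G := (hypercube n).
Implicit Types (x u v w : vtx) (p q : {ffun vtx -> R}) (t l : R).

Definition hdist x u := #|[set k | x k != u k]|.

Lemma hdist_adj x u v : adj u v -> (hdist x u <= (hdist x v).+1)%N.
Proof.
move=> /adjP[j ->]; apply: leq_trans (_ : #|j |: [set k | x k != flip u j k]| <= _)%N.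
  apply/subset_leq_card/subsetP => k; rewrite !inE ffunE.
  by case: (eqVneq k j) => //= _; rewrite addbF.
by rewrite cardsU1 -add1n leq_add2r; case: (_ \notin _).
Qed.

Lemma hdist_le1 x u : (hdist x u <= 1)%N -> x = u \/ adj u x.
Proof.
rewrite leq_eqVlt ltnS leqn0 cards_eq0 => /orP[h|/eqP/setP h].
  by right; rewrite adjC.
by left; apply/ffunP => k; have := h k; rewrite !inE => /negbFE/eqP.
Qed.

Lemma hdistxx x : hdist x x = 0%N.
Proof. by apply/eqP; rewrite cards_eq0; apply/eqP/setP => k; rewrite !inE eqxx. Qed.

(* Affine on each edge with slope at most 1, so that it bounds distances to [x]
   from below. *)
Definition potential x p : R := \sum_w p w * (hdist x w)%:R.

Lemma potential_edge x u v t : potential x (@edge_point R G u v t) =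
  (1 - t) * (hdist x u)%:R + t * (hdist x v)%:R.
Proof.
rewrite /potential; under eq_bigr do rewrite ffunE mulrDl.
rewrite big_split /=; congr (_ + _).
  rewrite (bigD1 u) //= eqxx mulr1 big1 ?addr0 // => w /negPf ->.
  by rewrite mulr0 mul0r.
rewrite (bigD1 v) //= eqxx mulr1 big1 ?addr0 // => w /negPf ->.
by rewrite mulr0 mul0r.
Qed.

Lemma potential_vertex x u : potential x (@vertex_point R G u) = (hdist x u)%:R.
Proof.
rewrite /potential (bigD1 u) //= ffunE eqxx mul1r big1 ?addr0 // => w /negPf wu.
by rewrite ffunE wu mul0r.
Qed.

Lemma hdist_lipschitz x u v : adj u v ->
  `|(hdist x u)%:R - (hdist x v)%:R| <= 1 :> R.
Proof.
move=> uv; have := hdist_adj x uv; rewrite adjC in uv; have := hdist_adj x uv.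
by rewrite -!(ler_nat R) -!natr1 => h1 h2; rewrite ler_norml; lra.
Qed.

Lemma potential_route x p q l : @route R G p q l -> potential x q <= potential x p + l.
Proof.
elim=> [y|u v s t y l' uv _ _ _ IH]; first by rewrite addr0.
apply: le_trans IH _; rewrite !potential_edge addrA lerD2r.
rewrite -lerBlDl; apply: le_trans (ler_norm _) _.
set a := _%:R; set b := _%:R.
have -> : (1 - t) * a + t * b - ((1 - s) * a + s * b) = (s - t) * (a - b) by ring.
by rewrite normrM ler_piMr // hdist_lipschitz.
Qed.

Lemma route_ge0 p q l : @route R G p q l -> 0 <= l.
Proof. by elim=> // *; apply: addr_ge0. Qed.

Lemma edge_point0 u v : @edge_point R G u v 0 = @vertex_point R G u.
Proof. by apply/ffunP => w; rewrite !ffunE subr0 mul1r mul0r addr0. Qed.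

Lemma edge_point1 u v : @edge_point R G u v 1 = @vertex_point R G v.
Proof. by apply/ffunP => w; rewrite !ffunE subrr mul1r mul0r add0r. Qed.

Lemma edge_point_rev u v t : @edge_point R G u v t = @edge_point R G v u (1 - t).
Proof. by apply/ffunP => w; rewrite !ffunE; ring. Qed.

Lemma route_step x u p l : adj x u -> @route R G (@vertex_point R G u) p l ->
  @route R G (@vertex_point R G x) p (1 + l).
Proof.
move=> xu r; rewrite -(edge_point0 x u) (_ : 1 = `|0 - 1|); last by rewrite sub0r normrN normr1.
by apply: (@route_cons R G x u 0 1); rewrite ?lexx ?ler01 // edge_point1.
Qed.

Lemma route_connect x u p l : connect adj x u ->
  @route R G (@vertex_point R G u) p l ->
  exists l', @route R G (@vertex_point R G x) p l'.
Proof.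
move=> /connectP[s + ->]; elim: s x l => /= [x l _ r|y s IH x l /andP[xy sP] r].
  by exists l.
by have [l' r'] := IH y l sP r; exists (1 + l'); apply: route_step xy r'.
Qed.

Lemma route_half u v t : adj u v -> 0 <= t <= 1 ->
  @route R G (@vertex_point R G u) (@edge_point R G u v t) (t + 0).
Proof.
move=> uv /andP[t0 t1]; rewrite -{1}(edge_point0 u v).
rewrite (_ : t + 0 = `|0 - t| + 0); last by rewrite sub0r normrN ger0_norm.
by apply: route_cons; rewrite ?lexx ?ler01 ?t0 //; apply: route_nil.
Qed.

Lemma potential_le_dist x p : @realization R G p ->
  potential x p <= @path_dist R G (@vertex_point R G x) p.
Proof.
move=> pG; apply: lb_le_inf => [|l /= /(potential_route x)].
  (* The infimum is over a nonempty set of lengths because the cube is connected. *)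
  have [[v ->]|[u [v [t [uv t01 ->]]]]] := pG.
    by have [l r] := route_connect (hypercube_adj_conn x v) (route_nil _); exists l.
  by have [l r] := route_connect (hypercube_adj_conn x u) (route_half uv t01); exists l.
by rewrite potential_vertex hdistxx add0r.
Qed.

Lemma dist_le_route x p l : @route R G (@vertex_point R G x) p l ->
  @path_dist R G (@vertex_point R G x) p <= l.
Proof. by move=> r; apply: ge_inf => //; exists 0 => l'; apply: route_ge0. Qed.

(** The midpoint of an edge is within 3/2 of all neighbours of its ends. Conversely, a vertex at
    Hamming distance at least 2 from both ends has potential at least 2 on the whole edge. *)
Lemma cech_cubeE (s : {set vtx}) : (0 < n)%N ->
  (s \in simplices (cech G (3 : R))) = (s != set0) && cube_face s.
Proof.
move=> n0; rewrite inE; congr (_ && _); apply/asboolP/cube_faceP.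
  case=> p ps; have [->|[x0 x0s]] := set_0Vmem s.
    pose o : vtx := [ffun=> false].
    by exists o, (flip o (Ordinal n0)); rewrite adj_flip; split=> // x; rewrite inE.
  have [pG _] := ps x0 x0s.
  have pot x : x \in s -> potential x p <= 3 / 2.
    by move=> xs; have [_] := ps x xs; apply: le_trans; apply: potential_le_dist.
  have [[v pE]|[u [v [t [uv /andP[t0 t1] pE]]]]] := pG.
    exists v, (flip v (Ordinal n0)); rewrite adj_flip; split=> // x xs.
    have := pot x xs; rewrite pE potential_vertex => h.
    have /hdist_le1[->|->//] : (hdist x v <= 1)%N.
      by rewrite leqNgt; apply/negP; rewrite -(ler_nat R); lra.
    by rewrite (adjC (flip _ _)) adj_flip orbT.
  exists u, v; split=> // x xs; have := pot x xs; rewrite pE potential_edge => h.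
  have uv' : adj u v by [].
  have [|hu] := leqP (hdist x u) 1%N.
    by case/hdist_le1 => [->|->//]; rewrite (adjC v) uv' orbT.
  have [|hv] := leqP (hdist x v) 1%N.
    by case/hdist_le1 => [->|->//]; rewrite ?uv' ?orbT.
  by move: hu hv; rewrite -!(ler_nat R) => hu hv; nra.
case=> a [b [ab h]]; exists (@edge_point R G a b 2^-1) => x xs.
have half : 0 <= (2^-1 : R) <= 1 by apply/andP; split; lra.
split; first by right; exists a, b, 2^-1.
have /orP[ax|bx] := h x xs.
  apply: le_trans (dist_le_route (route_step _ (route_half ab half))) _; last lra.
  by rewrite adjC.
rewrite edge_point_rev (_ : 1 - 2^-1 = 2^-1 :> R); last lra.
rewrite adjC in ab.
apply: le_trans (dist_le_route (route_step _ (route_half ab half))) _; last lra.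
by rewrite adjC.
Qed.

End EdgeBalls.

(** * Joins and pairings modulo 2 *)

Section Joins.
Variable V : finType.
Implicit Types (s t r : {set V}) (v x : V) (c : chain V) (A : pred {set V}).

Definition mod2_pairing A c : 'F_2 := \sum_(s | A s) (c s)%:~R.

Lemma mod2_pairing_is_zmod_morphism A : zmod_morphism (mod2_pairing A).
Proof.
by move=> c d; rewrite -sumrB; apply: eq_bigr => s _; rewrite !ffunE intrB.
Qed.
HB.instance Definition _ A := GRing.isZmodMorphism.Build (chain V) 'F_2
  (mod2_pairing A) (mod2_pairing_is_zmod_morphism A).

Lemma oppF2 (x : 'F_2) : - x = x.
Proof. by apply/eqP; move: x; do 2?[case] => // -[]. Qed.

Lemma natF2 k : k%:R = (odd k)%:R :> 'F_2.
Proof.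
elim: k => // k IH; rewrite -natr1 IH oddS.
by case: (odd k); apply/eqP.
Qed.

Lemma sg_mod2 s v (z : int) : (sg s v * z)%:~R = z%:~R :> 'F_2.
Proof.
by rewrite /sg -signr_odd; case: odd; rewrite ?mul1r // mulN1r rmorphN /= oppF2.
Qed.

Lemma pairing_cone A x c :
  mod2_pairing A (cone x c) = mod2_pairing [pred r : {set V} | (x \notin r) && A (x |: r)] c.
Proof.
rewrite /mod2_pairing (bigID (fun s : {set V} => x \in s)) /= [X in _ + X]big1 ?addr0; last first.
  by move=> s /andP[_ /negPf xs]; rewrite ffunE xs.
rewrite (reindex_onto (fun r : {set V} => x |: r) (fun s => s :\ x)) /=; last first.
  by move=> s /andP[_ xs]; rewrite setD1K.
apply: eq_big => [r|r /andP[/andP[_ _] /eqP xr]]; last first.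
  by rewrite ffunE setU11 sg_mod2 xr.
rewrite setU11 andbT andbC; have [xr|xr] := boolP (x \in r); last first.
  by rewrite setU1K ?eqxx.
by apply/negbTE; rewrite negb_and; apply/orP; left; apply: contraTneq xr => <-; rewrite !inE eqxx.
Qed.

Lemma pairing_face_del A v c :
  mod2_pairing A (face_del v c) = mod2_pairing [pred s : {set V} | (v \in s) && A (s :\ v)] c.
Proof.
rewrite /mod2_pairing (bigID (fun s : {set V} => v \in s)) /= big1 ?add0r; last first.
  by move=> s /andP[_ vs]; rewrite ffunE vs.
rewrite (reindex_onto (fun s : {set V} => s :\ v) (fun t => v |: t)) /=; last first.
  by move=> s /andP[_ vs]; rewrite setU1K.
apply: eq_big => [s|s /andP[/andP[_ vs] /eqP sE]]; last first.
  by rewrite ffunE (negPf vs) sg_mod2 sE.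
rewrite !inE eqxx /= andbT andbC; have [vs|vs] := boolP (v \in s).
  by rewrite setD1K ?eqxx.
by apply/negbTE; rewrite negb_and; apply/orP; left; apply: contraNneq vs => <-; rewrite setU11.
Qed.

(** Exchanging sums counts the facets in [A] of each simplex; even counts make [A] a cocycle modulo
    2 on the support. *)
Lemma pairing_bdry_eq0 A c :
  supported (fun s => ~~ odd #|[set v in s | A (s :\ v)]|) c ->
  mod2_pairing A (bdry c) = 0.
Proof.
move=> even; rewrite bdryE raddf_sum /=; under eq_bigr do rewrite pairing_face_del.
rewrite /mod2_pairing; under eq_bigr do rewrite big_mkcond.
rewrite exchange_big big1 //= => s _.
have [->|/even ev] := eqVneq (c s) 0; first by rewrite big1 // => v _; case: ifP.
rewrite -big_mkcond (eq_bigl (fun v => v \in [set v in s | A (s :\ v)])); last first.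
  by move=> v; rewrite inE.
by rewrite sumr_const -mulr_natr natF2 (negPf ev) mulr0.
Qed.

(** The empty simplex, a generator in degree -1 and the unit for joins. *)
Definition point_chain : chain V := [ffun s => (s == set0)%:R].

Definition cones (l : seq V) c := foldr (@cone V) c l.

(* The join of the boundaries of the full simplices on the parts. *)
Definition join_cycle (parts : seq (seq V)) : chain V :=
  foldr (fun P c => bdry (cones P c)) point_chain parts.

Fixpoint deletions (T : Type) (P : seq T) : seq (seq T) :=
  if P is x :: P' then P' :: [seq x :: d | d <- deletions P'] else [::].

Definition join_faces (T : Type) (parts : seq (seq T)) : seq (seq T) :=
  foldr (fun P ls => [seq d ++ l | d <- deletions P, l <- ls]) [:: [::]] parts.

Lemma bdry_point : bdry point_chain = 0.
Proof.
apply/ffunP => t; rewrite [RHS]ffunE; apply/eqP; apply: contraT => /bdry_supp[w wt].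
by rewrite ffunE -cards_eq0 cardsU1 wt.
Qed.

Lemma bdry_join_cycle parts : bdry (join_cycle parts) = 0.
Proof. by case: parts => [|P parts]; [exact: bdry_point|exact: bdry_bdry]. Qed.

Lemma bdry_cones_cons x P c : bdry (cones (x :: P) c) = cones P c - cone x (bdry (cones P c)).
Proof. exact: bdry_cone. Qed.

Lemma cones_supp l c s : cones l c s != 0 -> exists2 r, c r != 0 & s = [set x in l] :|: r.
Proof.
elim: l s => [|x l IH] s /=; first by exists s => //; apply/setP => y; rewrite !inE.
move=> /cone_supp[xs /IH[r cr sE]]; exists r => //.
apply/setP => y; rewrite -(setD1K xs) sE !inE; by case: (y == x).
Qed.

Lemma bdry_cones_supp P c s : bdry c = 0 -> bdry (cones P c) s != 0 ->
  exists d r, [/\ d \in deletions P, c r != 0 & s = [set x in d] :|: r].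
Proof.
move=> c0; elim: P s => [|x P IH] s; first by rewrite /= c0 ffunE eqxx.
rewrite bdry_cones_cons ffunE [X in _ + X]ffunE.
have [->|/cones_supp[r cr sE] _] := eqVneq (cones P c s) 0; last first.
  by exists P, r; rewrite inE eqxx.
rewrite add0r oppr_eq0 => /cone_supp[xs /IH[d [r [dP cr sE]]]].
exists (x :: d), r; split=> //; first by rewrite inE map_f ?orbT.
by apply/setP => y; rewrite -(setD1K xs) sE !inE; case: (y == x).
Qed.

Lemma join_cycle_supp parts s : join_cycle parts s != 0 ->
  exists2 l, l \in join_faces parts & s = [set x in l].
Proof.
elim: parts s => [|P parts IH] s /=.
  rewrite ffunE; have [->|] := eqVneq s set0; last by rewrite eqxx.
  by exists [::] => //; apply/setP => x; rewrite !inE.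
move=> /(bdry_cones_supp (bdry_join_cycle parts))[d [r [dP /IH[l lP rE] sE]]].
exists (d ++ l); first by apply: allpairs_f.
by rewrite sE rE; apply/setP => x; rewrite !inE mem_cat.
Qed.

Lemma pairing_cones A l c : mod2_pairing A (cones l c) =
  mod2_pairing [pred r : {set V} | [&& uniq l, [disjoint l & r] & A ([set x in l] :|: r)]] c.
Proof.
elim: l A => [|x l IH] A.
  apply: eq_bigl => r /=; rewrite disjoint_has /=; congr (A _).
  by apply/setP => y; rewrite !inE.
rewrite /= pairing_cone IH; apply: eq_bigl => r /=; rewrite disjoint_cons !inE.
have -> : x |: ([set y in l] :|: r) = [set y in x :: l] :|: r.
  by apply/setP => y; rewrite !inE orbA.
by rewrite negb_or; case: (uniq l); case: [disjoint l & r]; case: (x \in l); case: (x \in r).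
Qed.

(** The Leibniz rule for joins: as [c] is a cycle, only facets of [P] contribute, and signs
    disappear modulo 2. *)
Lemma pairing_bdry_cones A P c : bdry c = 0 ->
  mod2_pairing A (bdry (cones P c)) = \sum_(d <- deletions P) mod2_pairing A (cones d c).
Proof.
move=> c0; elim: P A => [|x P IH] A; first by rewrite /= c0 raddf0 big_nil.
rewrite bdry_cones_cons raddfB /= big_cons oppF2 big_map; congr (_ + _).
by rewrite pairing_cone IH; apply: eq_bigr => d _; rewrite -pairing_cone.
Qed.

(** Makes the pairing computable. Lists with a repeated vertex drop out because coning twice from
    one vertex gives zero. *)
Lemma pairing_join_cycle A parts : mod2_pairing A (join_cycle parts) =
  (count (fun l => uniq l && A [set x in l]) (join_faces parts))%:R.
Proof.
suff H : mod2_pairing A (join_cycle parts) =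
    \sum_(l <- join_faces parts) (uniq l && A [set x in l])%:R.
  by rewrite H -sum1_count natr_sum [RHS]big_mkcond; apply: eq_bigr => l _; case: ifP.
elim: parts A => [|P parts IH] A /=.
  rewrite big_seq1 /= (_ : [set x in [::]] = set0); last by apply/setP => x; rewrite !inE.
  rewrite /mod2_pairing; case: (boolP (A set0)) => A0.
    rewrite (bigD1 set0) //= ffunE eqxx big1 ?addr0 // => s /andP[_ /negPf s0].
    by rewrite ffunE s0.
  by rewrite big1 // => s As; rewrite ffunE; case: eqP As => // ->; rewrite (negPf A0).
rewrite pairing_bdry_cones ?bdry_join_cycle // big_allpairs_dep /=; apply: eq_bigr => d _.
rewrite pairing_cones IH; apply: eq_bigr => l _; congr (nat_of_bool _)%:R.
rewrite /=; have -> : [set x in d] :|: [set x in l] = [set x in d ++ l].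
  by apply/setP => y; rewrite !inE mem_cat.
rewrite cat_uniq /=; have -> : [disjoint d & [set x in l]] = ~~ has (mem d) l.
  rewrite disjoint_sym disjoint_subset; apply/subsetP/hasPn => h x.
    by move=> xl; apply: h; rewrite !inE.
  by rewrite !inE => /h.
by case: (uniq d); case: (uniq l); case: (has _ _).
Qed.

End Joins.

(** * Cycles in degrees 3 and 4 *)

Fixpoint sublists (F : seq nat) (k : nat) : seq (seq nat) :=
  match k, F with
  | 0, _ => [:: [::]]
  | _, [::] => [::]
  | k'.+1, x :: F' => [seq x :: l | l <- sublists F' k'] ++ sublists F' k
  end.

Lemma mem_sublists F l : sorted ltn F -> sorted ltn l -> {subset l <= F} ->
  l \in sublists F (size l).
Proof.
elim: F l => [|x F IH] [|y l] //= sF sl lF; first by have := lF y (mem_head _ _).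
have sF' := path_sorted sF; have sl' := path_sorted sl.
have xF : all (ltn x) F by apply: order_path_min sF; exact: ltn_trans.
have yl : all (ltn y) l by apply: order_path_min sl; exact: ltn_trans.
rewrite mem_cat; have [xy|xy] := eqVneq y x.
  rewrite xy map_f //; apply: IH => // z zl.
  have := lF z; rewrite !inE zl orbT => /(_ isT)/predU1P[zx|//].
  by have := allP yl _ zl; rewrite /= xy zx ltnn.
apply/orP; right; apply: (IH (y :: l)) => // z zl.
have := lF z zl; rewrite inE => /predU1P[zx|//]; exfalso.
have yF : y \in F by move: (lF y (mem_head _ _)); rewrite inE (negPf xy).
move: zl (allP xF _ yF); rewrite zx inE eq_sym (negPf xy) /= => /(allP yl) /=.
by move=> yx /(ltn_trans yx); rewrite ltnn.
Qed.

(** Handles simplices on which the projection is not injective. Only the deletion of a value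
    occurring exactly twice can remove all repetitions, and that deletion is counted twice. *)
Lemma even_count_rem (C : seq (seq nat)) l : all uniq C -> ~~ uniq l ->
  ~~ odd (count (fun c => rem c l \in C) l).
Proof.
move=> uC nul; have [/hasP[x xl xC]|/hasPn h] := boolP (has (fun c => rem c l \in C) l);
  last by rewrite (eq_in_count (a2 := pred0)) ?count_pred0 // => x /h /negPf.
have ux : uniq (rem x l) := allP uC _ xC.
have pl := perm_to_rem xl.
have xx : x \in rem x l.
  by move: nul; rewrite (perm_uniq pl) /= ux andbT negbK.
rewrite (eq_in_count (a2 := pred1 x)).
  by rewrite (permP pl) /= eqxx (count_uniq_mem _ ux) xx.
move=> y yl /=; have [->//|yx] := eqVneq y x; apply/negbTE/negP => /(allP uC) /=.
move=> /(count_uniq_mem x) cx; have := permP (perm_to_rem yl) (pred1 x).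
rewrite (permP pl) /= eqxx (negPf yx) (count_uniq_mem _ ux) xx cx.
by case: (x \in rem y l).
Qed.

Section SmallCubes.
Variable d : nat.

Definition flip_bit (u : seq bool) (k : nat) : seq bool :=
  mkseq (fun j => nth false u j (+) (j == k)) d.

Definition bits (c : nat) : seq bool := mkseq (fun j => odd (iter j half c)) d.

Definition bits_val (u : seq bool) : nat := foldr (fun (b : bool) m => b + m.*2)%N 0%N u.

Fixpoint all_bits (k : nat) : seq (seq bool) :=
  if k is k'.+1 then [seq false :: u | u <- all_bits k'] ++ [seq true :: u | u <- all_bits k']
  else [:: [::]].

(* The index [k = d] stands for the flips that the projection forgets. *)
Definition flips (u : seq bool) : seq (seq bool) := [seq flip_bit u k | k <- iota 0 d.+1].

Definition edge_codes (u u' : seq bool) : seq nat :=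
  let us := map bits_val (flips u ++ flips u') in
  [seq c <- iota 0 (2 ^ d) | c \in us].

(** The cocycle condition modulo 2 as a finite check on images of simplices under the projection;
    the [uniq] clause settles the degenerate images. *)
Definition even_pairing (C : seq (seq nat)) (m : nat) : bool :=
  all uniq C && all (fun u => all (fun k =>
    all (fun l => ~~ odd (count (fun c => rem c l \in C) l))
      (sublists (edge_codes u (flip_bit u k)) m.+1)) (iota 0 d)) (all_bits d).

Definition small_face (l : seq nat) : bool :=
  has (fun u => has (fun k =>
    all (fun c => has (fun j => (bits c == flip_bit u j) ||
      (bits c == flip_bit (flip_bit u k) j)) (iota 0 d)) l) (iota 0 d)) (all_bits d).

Definition good_join (C : seq (seq nat)) (m : nat) (parts : seq (seq nat)) : bool :=
  let ls := join_faces parts in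
  [&& all (all (fun c => bits_val (bits c) == c)) ls, all uniq ls,
    all (fun l => size l == m) ls,
    all small_face ls & odd (count (fun l => sort leq l \in C) ls)].

Lemma mem_all_bits u : u \in all_bits (size u).
Proof.
by elim: u => //= -[] u IH; rewrite mem_cat map_f ?orbT.
Qed.

Lemma size_all_bits k u : u \in all_bits k -> size u = k.
Proof.
elim: k u => [|k IH] u /=; first by rewrite inE => /eqP->.
by rewrite mem_cat => /orP[] /mapP[u' /IH <- ->].
Qed.

Lemma bits_val_lt u : (bits_val u < 2 ^ size u)%N.
Proof. by elim: u => //= -[] u; rewrite expnS; lia. Qed.

End SmallCubes.

Lemma deletions_map (T U : Type) (g : T -> U) P :
  deletions (map g P) = map (map g) (deletions P).
Proof. by elim: P => //= x P ->; rewrite -!map_comp. Qed.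

Lemma join_faces_map (T U : Type) (g : T -> U) parts :
  join_faces (map (map g) parts) = map (map g) (join_faces parts).
Proof.
elim: parts => //= P parts ->; rewrite deletions_map map_allpairs.
rewrite allpairs_mapl allpairs_mapr; congr flatten; apply: eq_map => x /=.
by apply: eq_map => y; rewrite map_cat.
Qed.

(** * Pulling cocycles back along the projection onto a subcube *)

Section Projection.
Variables (n d : nat) (dn : (d <= n)%N).
Local Notation vtx := (hypercube_vertex n).
Local Notation adj := (@hypercube_adj n).
Implicit Types (x y v : vtx) (s : {set vtx}) (u : seq bool).

Definition coord x (j : nat) := if insub j is Some k then x k else false.

Definition proj x : seq bool := mkseq (coord x) d.

Definition embed u : vtx := [ffun k : 'I_n => nth false u k].

(** Repetitions are kept, so simplices squashed by the projection remain recognizable. *)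
Definition code s : seq nat := sort leq [seq bits_val (proj x) | x <- enum s].

Lemma size_proj x : size (proj x) = d.
Proof. exact: size_mkseq. Qed.

Lemma coord_flip x k j : coord (flip x k) j = coord x j (+) (j == k).
Proof.
rewrite /coord; case: insubP => [i _ <-|jn]; first by rewrite ffunE.
by apply/esym/negbTE/eqP => jk; rewrite jk ltn_ord in jn.
Qed.

Lemma proj_flip x (k : 'I_n) : proj (flip x k) = flip_bit d (proj x) k.
Proof.
apply: (@eq_from_nth _ false); rewrite ?size_mkseq // => j jd.
by rewrite !nth_mkseq // coord_flip.
Qed.

Lemma flip_bit_out u k : (d <= k)%N -> flip_bit d u k = flip_bit d u d.
Proof.
move=> dk; apply: (@eq_from_nth _ false); rewrite ?size_mkseq // => j jd.
by rewrite !nth_mkseq // (ltn_eqF (leq_trans jd dk)) (ltn_eqF jd).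
Qed.

Lemma proj_adj x y : adj x y -> proj y \in flips d (proj x).
Proof.
move=> /adjP[k ->]; rewrite proj_flip; have [kd|dk] := ltnP k d.
  by apply: map_f; rewrite mem_iota add0n ltnS (ltnW kd).
by rewrite flip_bit_out //; apply: map_f; rewrite mem_iota add0n ltnSn.
Qed.

Lemma projK u : size u = d -> proj (embed u) = u.
Proof.
move=> ud; apply: (@eq_from_nth _ false); rewrite ?size_mkseq ?ud // => j jd.
rewrite nth_mkseq // /coord; case: insubP => [i _ ij|]; first by rewrite ffunE ij.
by rewrite (leq_trans jd dn).
Qed.

Lemma embed_adj u k : size u = d -> (k < d)%N -> adj (embed u) (embed (flip_bit d u k)).
Proof.
move=> ud kd; apply/adjP; exists (Ordinal (leq_trans kd dn)); apply/ffunP => i.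
rewrite !ffunE -val_eqE /=; have [id|di] := ltnP i d; first by rewrite nth_mkseq.
by rewrite !nth_default ?size_mkseq ?ud // (gtn_eqF (leq_trans kd di)).
Qed.

Lemma code_del s v : v \in s -> code (s :\ v) = rem (bits_val (proj v)) (code s).
Proof.
move=> vs; set f := fun x => bits_val (proj x).
have pe : perm_eq (enum s) (v :: enum (s :\ v)).
  apply: uniq_perm; rewrite /= ?enum_uniq ?mem_enum ?inE ?eqxx //.
  by move=> x; rewrite inE !mem_enum !inE; case: eqP => [->|].
have pl : perm_eq (code s) (f v :: code (s :\ v)).
  by rewrite perm_sort (permPl (perm_map f pe)) /= perm_cons perm_sym perm_sort.
have vl : f v \in code s by rewrite (perm_mem pl) mem_head.
apply: (sorted_eq leq_trans anti_leq); first exact/sort_sorted/leq_total.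
  exact/(subseq_sorted leq_trans (rem_subseq _ _))/sort_sorted/leq_total.
by rewrite -(perm_cons (f v)) -(permPl pl) perm_to_rem.
Qed.

Lemma card_code s (P : pred nat) :
  #|[set v in s | P (bits_val (proj v))]| = count P (code s).
Proof.
rewrite (permP (permEl (perm_sort _ _))) count_map cardE -size_filter.
rewrite -filter_predI; congr size; apply: eq_filter => x.
by rewrite !inE andbC.
Qed.

Lemma even_faces (C : seq (seq nat)) m s : (0 < d)%N -> even_pairing d C m ->
  cube_face s -> #|s| = m.+1 -> ~~ odd #|[set v in s | code (s :\ v) \in C]|.
Proof.
move=> d0 /andP[uC ev] /cube_faceP[a [b [ab h]]] sm.
have -> : [set v in s | code (s :\ v) \in C] =
    [set v in s | rem (bits_val (proj v)) (code s) \in C].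
  by apply/setP => v; rewrite !inE; case: (boolP (v \in s)) => // vs; rewrite code_del.
rewrite (card_code s (fun c => rem c (code s) \in C)).
have [ul|] := boolP (uniq (code s)); last exact: even_count_rem.
have sl : size (code s) = m.+1 by rewrite size_sort size_map -cardE.
have [k kd bk] : exists2 k, (k < d)%N & forall y, adj b y ->
    proj y \in flips d (proj a) ++ flips d (flip_bit d (proj a) k).
  have /adjP[k bE] := ab; have [kd|dk] := ltnP k d.
    by exists k => // y /proj_adj; rewrite bE proj_flip mem_cat => ->; rewrite orbT.
  (* The edge points in a forgotten direction and projects to one vertex; any edge there serves,
     here the one in direction 0. *)
  exists 0%N => // y /proj_adj; rewrite bE proj_flip mem_cat.
  suff -> : flip_bit d (proj a) k = proj a by move=> ->.
  apply: (@eq_from_nth _ false); rewrite ?size_mkseq // => j jd.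
  by rewrite nth_mkseq // (ltn_eqF (leq_trans jd dk)) addbF.
have := allP ev (proj a); rewrite -{1}(size_proj a) mem_all_bits => /(_ isT)/allP/(_ k).
rewrite mem_iota kd => /(_ isT)/allP; apply; rewrite -sl; apply: mem_sublists.
- exact/(sorted_filter ltn_trans)/iota_ltn_sorted.
- by rewrite ltn_sorted_uniq_leq ul; exact/sort_sorted/leq_total.
move=> c; rewrite mem_sort => /mapP[x]; rewrite mem_enum => xs ->.
rewrite mem_filter mem_iota add0n; apply/andP; split; last first.
  by have := bits_val_lt (proj x); rewrite size_proj.
apply: (map_f bits_val); have /orP[/proj_adj|/bk//] := h x xs.
by rewrite mem_cat => ->.
Qed.

Lemma small_cube_face l : small_face d l -> cube_face [set x in map (embed \o bits d) l].
Proof.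
move=> /hasP[u /size_all_bits ud /hasP[k]]; rewrite mem_iota /= add0n => kd /allP h.
apply/cube_faceP; exists (embed u), (embed (flip_bit d u k)); split; first exact: embed_adj.
move=> x; rewrite inE => /mapP[c /h/hasP[j]]; rewrite mem_iota /= add0n => jd.
by move=> /orP[] /eqP-> ->; rewrite embed_adj ?orbT // size_mkseq.
Qed.

Lemma code_embed l : uniq l -> all (fun c => bits_val (bits d c) == c) l ->
  uniq (map (embed \o bits d) l) /\
  code [set x in map (embed \o bits d) l] = sort leq l.
Proof.
move=> ul /allP lE; set g := embed \o bits d.
have fg : map (fun x => bits_val (proj x)) (map g l) = l.
  rewrite -map_comp -[RHS]map_id; apply/eq_in_map => c /lE/eqP cE.
  by rewrite /= projK ?size_mkseq.
have ug : uniq (map g l) by apply: (@map_uniq _ _ (fun x => bits_val (proj x))); rewrite fg.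
split=> //; apply/perm_sortP; [exact: leq_total|exact: leq_trans|exact: anti_leq|].
rewrite -[X in perm_eq _ X]fg; apply: perm_map; apply: uniq_perm => //.
  exact: enum_uniq.
by move=> x; rewrite mem_enum inE.
Qed.

Lemma join_not_boundary (C : seq (seq nat)) m parts : (0 < d)%N ->
  even_pairing d C m -> good_join d C m parts ->
  exists c : chain vtx, [/\ bdry c = 0,
    supported (fun s => cube_face s /\ #|s| = m) c &
    forall b : chain vtx, supported (fun s => cube_face s /\ #|s| = m.+1) b -> bdry b <> c].
Proof.
move=> d0 ev /and5P[/allP val /allP unq /allP siz /allP fac od].
pose g := embed \o bits d.
exists (join_cycle (map (map g) parts)); split.
- exact: bdry_join_cycle.
- move=> s /join_cycle_supp[l0]; rewrite join_faces_map => /mapP[l lP ->] ->.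
  have [ug _] := code_embed (unq l lP) (val l lP).
  split; first exact/small_cube_face/fac.
  rewrite -(eqP (siz l lP)) -(size_map g) -(card_uniqP ug); apply: eq_card => x.
  by rewrite inE.
move=> b bK bE.
have := pairing_join_cycle (fun s => code s \in C) (map (map g) parts).
rewrite -bE pairing_bdry_eq0; last first.
  by move=> s /bK[sK sm]; apply: even_faces d0 ev sK sm.
rewrite join_faces_map count_map; rewrite (eq_in_count (a2 := fun l => sort leq l \in C)).
  by rewrite natF2 od.
by move=> l lP /=; have [-> ->] := code_embed (unq l lP) (val l lP).
Qed.

End Projection.

(* The 3-dimensional simplices of the 4-cube whose convex hull meets the ray from
   the centre of [-1, 1]^4 through (7, 3, 2, 1). As no simplex of the complex
   contains the centre in its convex hull, counting them modulo 2 computes a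
   winding number, which is a cocycle. *)
Definition winding4 : seq (seq nat) :=
  [:: [:: 1; 2; 5; 15]; [:: 1; 2; 6; 15]; [:: 1; 2; 7; 15]; [:: 1; 3; 4; 15];
      [:: 1; 3; 5; 15]; [:: 1; 3; 6; 15]; [:: 1; 3; 7; 15]; [:: 1; 6; 11; 15];
      [:: 1; 7; 10; 15]; [:: 1; 7; 11; 15]; [:: 2; 5; 11; 15]; [:: 2; 7; 9; 15];
      [:: 3; 4; 13; 15]; [:: 3; 5; 11; 14]; [:: 3; 5; 11; 15]; [:: 3; 5; 13; 14];
      [:: 3; 5; 13; 15]; [:: 3; 6; 11; 13]; [:: 3; 6; 13; 14]; [:: 3; 6; 13; 15];
      [:: 3; 7; 9; 14]; [:: 3; 7; 9; 15]; [:: 3; 7; 10; 13]; [:: 3; 7; 11; 13];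
      [:: 3; 7; 13; 14]; [:: 3; 7; 13; 15]; [:: 5; 6; 11; 13]; [:: 5; 6; 11; 14];
      [:: 5; 6; 11; 15]; [:: 5; 7; 11; 12]; [:: 5; 7; 11; 13]; [:: 5; 7; 11; 14];
      [:: 5; 7; 11; 15]; [:: 7; 9; 10; 13]; [:: 7; 9; 10; 14]; [:: 7; 9; 10; 15];
      [:: 7; 9; 11; 12]; [:: 7; 9; 11; 13]; [:: 7; 9; 11; 14]; [:: 7; 9; 11; 15]]%N.

(* The two 4-dimensional faces of the maximal simplex around the edge 04 of the
   3-cube that lie in no other maximal simplex. *)
Definition free_faces3 : seq (seq nat) := [:: [:: 0; 1; 2; 5; 6]; [:: 1; 2; 4; 5; 6]]%N.

Lemma winding4_cocycle : even_pairing 4 winding4 4.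
Proof. by vm_compute. Qed.

Lemma free_faces3_cocycle : even_pairing 3 free_faces3 5.
Proof. by vm_compute. Qed.

(** The boundary of a triangle joined with two pairs of points is a 3-sphere; its facets have 2 + 1
    + 1 vertices. *)
Lemma join4_good : good_join 4 winding4 4 [:: [:: 0; 3; 13]; [:: 1; 14]; [:: 6; 10]]%N.
Proof. by vm_compute. Qed.

(** The tetrahedron boundary on the odd vertices joined with a triangle boundary on three even ones
    is a 4-sphere; its facets have 3 + 2 vertices. *)
Lemma join3_good : good_join 3 free_faces3 5 [:: [:: 1; 2; 4; 7]; [:: 3; 5; 6]]%N.
Proof. by vm_compute. Qed.

(** * Homology of the cube complex, with degrees shifted to numbers of vertices *)

Section CubeHomology.
Variables (R : realType) (n : nat).
Hypothesis n4 : (4 <= n)%N.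
Local Notation K := (cech (hypercube n) (3 : R)).

Lemma cube_simplexE (s : {set hypercube_vertex n}) :
  (s == set0) || (s \in simplices K) = cube_face s.
Proof.
have n0 : (0 < n)%N by lia.
rewrite (cech_cubeE R s n0); have [->|//] := eqVneq s set0; apply/esym/cube_faceP.
pose o : hypercube_vertex n := [ffun=> false].
by exists o, (flip o (Ordinal n0)); rewrite adj_flip; split=> // x; rewrite inE.
Qed.

Lemma chains_cubeP (m : nat) (c : chain (hypercube_vertex n)) :
  reflect (supported (fun s => cube_face s /\ #|s| = m) c) (c \in chains K (m%:Z - 1)).
Proof.
rewrite inE; apply: (iffP forallP) => h s; have := h s.
  move=> /implyP hs /hs; rewrite /is_simplex_of_dim cube_simplexE subrK.
  by move=> /andP[? /eqP[]].
move=> hs; apply/implyP => /hs[sK sm].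
by rewrite /is_simplex_of_dim cube_simplexE subrK sK sm eqxx.
Qed.

Lemma cube_homology_vanish (m : nat) :
  ((m <= 3) || (6 <= m))%N -> ~ exists h : reduced_homology K (m%:Z - 1), h != 0.
Proof.
move=> m36 /homology_neq0P[c /andP[/chains_cubeP cK /eqP c0]]; apply.
have [b bK bE] : exists2 b : chain (hypercube_vertex n),
    supported (fun s => cube_face s) b & bdry b = c.
  have n0 : (0 < n)%N by lia.
  by case/orP: m36 => m36; [apply: low_cycle_bounds cK|apply: high_cycle_bounds cK].
exists (restr (fun s => #|s| == m.+1) b); last first.
  by apply: bdry_restr_card => // s /cK[].
rewrite (_ : m%:Z - 1 + 1 = m.+1%:Z - 1); last by lia.
by apply/chains_cubeP => s /restr_supp[/eqP sm /bK].
Qed.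

Lemma cube_homology_nonzero (d m : nat) C parts : (0 < d <= n)%N ->
  even_pairing d C m -> good_join d C m parts ->
  exists h : reduced_homology K (m%:Z - 1), h != 0.
Proof.
move=> /andP[d0 dn] ev gd; apply/homology_neq0P.
have [c [c0 cK cB]] := join_not_boundary dn d0 ev gd; exists c.
  by apply/andP; split; [apply/chains_cubeP|apply/eqP].
move=> [b bC bE]; apply: (cB b _ bE); apply/chains_cubeP; move: bC.
by rewrite (_ : m%:Z - 1 + 1 = m.+1%:Z - 1); last lia.
Qed.

End CubeHomology.

Theorem theorem5p13 (R : realType) (n : nat) (hn : (4 <= n)%N) (i : int) :
  (exists h : reduced_homology (cech (hypercube n) (3 : R)) i, h != 0) <->
  (i = 3 \/ i = 4).
Proof.
split=> [hi|[->|->]].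
- have [i0|i0] := leP (-1) i; last first.
    (* Below degree -1 a simplex would have negative cardinality, so every chain is zero. *)
    have /homology_neq0P[c /andP[cC _] []] := hi; exists 0; first exact: rpred0.
    rewrite raddf0; apply/esym/ffunP => s; rewrite [RHS]ffunE; apply/eqP.
    by apply: contraT => cs; have := forallP cC s; rewrite cs /= => /andP[_ /eqP]; lia.
  have [m iE] : exists m : nat, i = m%:Z - 1 by exists (absz (i + 1)); lia.
  move: hi; rewrite iE => hi.
  have [hm|] := boolP ((m <= 3) || (6 <= m))%N; last by lia.
  by case: (@cube_homology_vanish R n hn m hm).
- apply: (@cube_homology_nonzero R n hn 4 4 winding4); last exact: join4_good.
    by [].
  exact: winding4_cocycle.
- apply: (@cube_homology_nonzero R n hn 3 5 free_faces3); last exact: join3_good.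
    by rewrite (leq_trans _ hn).
  exact: free_faces3_cocycle.
Qed.
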